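(* For every even positive integer $u$ there exists a 2-D $(u\times 3,4,2)$-OOC with exactly $J^*(u\times 3)$ codewords.
   Context: A 2-D $(u\times v,4,2)$-OOC is a family $\mathcal C$ of $u\times v$ $(0,1)$-matrices of Hamming weight $4$ such that for all $A=(a_{ij}),B=(b_{ij})\in\mathcal C$ and integers $r$ with $A\ne B$ or $r\not\equiv0\pmod v$, $\sum_{i,j}a_{ij}b_{i,j+r}\le 2$ (column indices mod $v$). Write $N=\lfloor\frac{uv-1}{3}\lfloor\frac{uv-2}{2}\rfloor\rfloor$. Let $A=\{(u,v):u\equiv0\ (\mathrm{mod}\ 12),\ v\equiv2,4\ (\mathrm{mod}\ 6)\}$ and $B=\{(u,v):uv\equiv0\ (\mathrm{mod}\ 12),\ v\equiv0\ (\mathrm{mod}\ 6)\}$. Define $J^*(u\times v)$ as: $\lfloor\frac{u}{4}N\rfloor-1$ if $u\equiv7,11\pmod{12}$ and $v=2$; $\lfloor\frac{u}{4}(N-1)\rfloor$ if either ($uv\equiv0\pmod 6$ and $(u,v)\notin A\cup B$) or ($uv\equiv4,8\pmod{12}$ and $v$ even); $\lfloor\frac{u}{4}(N-1)\rfloor-1$ if $(u,v)\in A$; $\lfloor\frac{u}{4}(N-2)\rfloor$ if $(u,v)\in B$; and $\lfloor\frac{u}{4}N\rfloor$ otherwise. *)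

(* Defs.v *)
From mathcomp Require Import all_boot all_order all_algebra.
Set Implicit Arguments. Unset Strict Implicit. Unset Printing Implicit Defensive.

Definition hweight (u v : nat) (A : 'M[bool]_(u, v)) : nat :=
  \sum_(i < u) \sum_(j < v) (A i j : nat).

Definition corr (u v : nat) (A B : 'M[bool]_(u, v)) (r : nat) : nat :=
  \sum_(i < u) \sum_(j < v) \sum_(k < v | val k == (j + r) %% v) (A i j && B i k : nat).

Definition is_OOC_4_2 (u v : nat) (C : {set 'M[bool]_(u, v)}) : Prop :=
  (forall A, A \in C -> hweight A = 4) /\
  (forall A B (r : nat), A \in C -> B \in C -> (A != B) || (r %% v != 0) ->
     corr A B r <= 2).

Definition Nbound (u v : nat) : nat := ((u * v - 1) * ((u * v - 2) %/ 2)) %/ 3.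

Definition inA (u v : nat) : bool := (u %% 12 == 0) && ((v %% 6 == 2) || (v %% 6 == 4)).
Definition inB (u v : nat) : bool := (u * v %% 12 == 0) && (v %% 6 == 0).

Definition Jstar (u v : nat) : nat :=
  let N := Nbound u v in
  if ((u %% 12 == 7) || (u %% 12 == 11)) && (v == 2) then (u * N) %/ 4 - 1
  else if ((u * v %% 6 == 0) && ~~ (inA u v || inB u v))
          || (((u * v %% 12 == 4) || (u * v %% 12 == 8)) && ~~ odd v)
       then (u * (N - 1)) %/ 4
  else if inA u v then (u * (N - 1)) %/ 4 - 1
  else if inB u v then (u * (N - 2)) %/ 4
  else (u * N) %/ 4.

(* Main.v *)
(** Write [u = 2 m] and arrange the points [(row, column)] in [m] groups of two rows, i.e.
    of the form [j * (bool * 'I_3)]; codewords are then 4-subsets, and the condition says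
    that no triple of points lies in two of their column shifts. It suffices to find a
    shift-invariant family of 4-subsets covering every triple that is not contained in a
    group exactly once (a group design, [design false]): inside every group one adds the
    complement of a column, and counting the covered triples gives [Jstar] orbits.

    Group designs are built by recursion on [m]. Those on [3 k] and [3 k + 1] groups come
    from a tripling of the designs on [k] and [k + 1] groups, those on [2 k] groups from a
    doubling by a one-factorization. For [m = 6 j + 5], a design on [j + 1] groups is a Steiner
    system on [m + 1] points with blocks of sizes 4 and 6; remove a point and give weight 6 to
    the others, filling in the designs with 3 and 5 groups on the blocks through the removed
    point and transversal designs ([design true]) on the other blocks. *)
Require Import Defs.
From mathcomp Require Import all_boot all_order all_algebra.
From mathcomp Require Import zify.
Set Implicit Arguments. Unset Strict Implicit. Unset Printing Implicit Defensive.
Import GRing.Theory.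
Local Open Scope ring_scope.

(** * Decompositions of triple systems into quadruples *)

(* [q x y z] is the fourth point of the block through a triple of [T]; storing the blocks as
   such a partial operation makes the uniqueness of the block automatic. *)
Definition quad_map (P : eqType) (s : P -> P) (T : P -> P -> P -> bool)
    (q : P -> P -> P -> P) : Prop :=
  forall x y z, T x y z ->
  [/\ T y x z /\ q y x z = q x y z,
      T x z y /\ q x z y = q x y z,
      T x y (q x y z) /\ q x y (q x y z) = z,
      T (s x) (s y) (s z) /\ q (s x) (s y) (s z) = s (q x y z)
    & x != y /\ q x y z != z].

Definition decomposable (P : eqType) (s : P -> P) (T : P -> P -> P -> bool) :=
  exists q, quad_map s T q.

Section Calculus.
Variables (P : eqType) (s : P -> P).

Lemma decomposable_eq (T T' : P -> P -> P -> bool) :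
  (forall x y z, T x y z = T' x y z) -> decomposable s T -> decomposable s T'.
Proof.
move=> E [q qP]; exists q => x y z; rewrite -!E; exact: qP.
Qed.

(** The block through a triple of [T j] has all its triples in [T j], so the operations of disjoint
    pieces can be glued. *)
Lemma decomposable_union (J : finType) (T : J -> P -> P -> P -> bool) :
  (forall j, decomposable s (T j)) ->
  (forall i j x y z, T i x y z -> T j x y z -> i = j) ->
  decomposable s (fun x y z => [exists j, T j x y z]).
Proof.
move=> /fin_all_exists [q qP] uT.
pose Q x y z := if [pick j | T j x y z] is Some j then q j x y z else x.
have QE j x y z : T j x y z -> Q x y z = q j x y z.
  rewrite /Q; case: pickP => [i Ti Tj|/(_ j) -> //].
  by rewrite (uT _ _ _ _ _ Ti Tj).
exists Q => x y z /existsP [j Tj].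
have [[T1 e1] [T2 e2] [T3 e3] [T4 e4] [ne ne']] := qP j _ _ _ Tj.
have ex a b c : T j a b c -> [exists i, T i a b c] by move=> H; apply/existsP; exists j.
by rewrite (QE _ _ _ _ Tj) (QE _ _ _ _ T1) (QE _ _ _ _ T2) (QE _ _ _ _ T3)
  (QE _ _ _ _ T4); split; split=> //; apply: ex.
Qed.

Lemma decomposable_union2 (T1 T2 : P -> P -> P -> bool) :
  decomposable s T1 -> decomposable s T2 ->
  (forall x y z, T1 x y z -> T2 x y z -> false) ->
  decomposable s (fun x y z => T1 x y z || T2 x y z).
Proof.
move=> d1 d2 dis.
apply: (decomposable_eq (T := fun x y z =>
   [exists b : bool, (if b then T1 else T2) x y z])).
  move=> x y z; apply/existsP/orP => [[[] ?]|[] ?]; by [left|right|exists true|exists false].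
apply: (decomposable_union (T := fun b : bool => if b then T1 else T2)); first by case.
by move=> [] [] x y z //= h1 h2; have := dis x y z; rewrite h1 h2 => /(_ isT isT).
Qed.

(** The inverse laws are asked only at points occurring in triples, so that systems can pass between
    a subtype and its ambient type. *)
Lemma decomposable_transport (P' : eqType) (s' : P' -> P') (T : P -> P -> P -> bool)
    (T' : P' -> P' -> P' -> bool) (f : P -> P') (g : P' -> P) :
  (forall x y z, T x y z ->
     [/\ T' (f x) (f y) (f z), g (f x) = x, g (f y) = y & g (f z) = z]) ->
  (forall x y z, T' x y z ->
     [/\ T (g x) (g y) (g z), f (g x) = x, f (g y) = y & f (g z) = z]) ->
  (forall x, f (s x) = s' (f x)) ->
  decomposable s T -> decomposable s' T'.
Proof.
move=> fP gP fs [q qP].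
exists (fun x y z => f (q (g x) (g y) (g z))) => x y z T'xyz.
have [Txyz fgx fgy fgz] := gP _ _ _ T'xyz.
have [[T1 e1] [T2 e2] [T3 e3] [T4 e4] [ne ne']] := qP _ _ _ Txyz.
have [T1' _ _ _] := fP _ _ _ T1.
have [T2' _ _ _] := fP _ _ _ T2.
have [T3' _ _ gfq] := fP _ _ _ T3.
have [T4' gsx gsy gsz] := fP _ _ _ T4.
rewrite !fs in T4' gsx gsy gsz; rewrite !fgx !fgy !fgz in T1' T2' T3' T4' gsx gsy gsz.
split; split=> //.
- by rewrite e1.
- by rewrite e2.
- by rewrite gfq e3.
- by rewrite gsx gsy gsz e4 fs.
- by apply: contraNneq ne => ->.
- by apply: contraNneq ne' => e; rewrite -gfq e.
Qed.
End Calculus.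

(** * Blocks as sets *)

Definition distinct3 (V : eqType) (x y z : V) := [&& x != y, x != z & y != z].

Definition block (P : finType) (q : P -> P -> P -> P) (x y z : P) := [set x; y; z; q x y z].

Section Blocks.
Variables (P : finType) (s : P -> P) (T : P -> P -> P -> bool) (q : P -> P -> P -> P).
Hypothesis qP : quad_map s T q.

Lemma quad_neq x y z : T x y z -> [/\ distinct3 x y z, q x y z != x, q x y z != y & q x y z != z].
Proof.
move=> t; have [[t1 e1] [t2 e2] _ _ [xy wz]] := qP t.
have [_ [t3 e3] _ _ _] := qP t1.
have [_ _ _ _ [xz wy]] := qP t2; have [_ _ _ _ [yz wx]] := qP t3.
by rewrite e3 e1 in wx; rewrite e2 in wy; rewrite /distinct3 xy xz yz.
Qed.

Lemma card_block x y z : T x y z -> #|block q x y z| = 4.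
Proof.
move=> /quad_neq[/and3P[xy xz yz] wx wy wz]; rewrite /block.
rewrite -!setUA !cardsU1 !inE cards1 (negbTE xy) (negbTE xz) (negbTE yz).
by rewrite !(eq_sym _ (q x y z)) (negbTE wx) (negbTE wy) (negbTE wz).
Qed.

Lemma quad_block x y z a b c : T x y z -> distinct3 a b c ->
  a \in block q x y z -> b \in block q x y z -> c \in block q x y z ->
  T a b c /\ block q a b c = block q x y z.
Proof.
move=> t /and3P[ab ac bc].
(* [B] is invariant under the adjacent transpositions [B12], [B23], [B34], hence under all
   permutations of the four points. *)
pose B a b c d := T a b c /\ q a b c = d.
have Bxyz : B x y z (q x y z) by [].
have B12 u v w d : B u v w d -> B v u w d by case=> /qP[[? <-] _ _ _ _] <-.
have B23 u v w d : B u v w d -> B u w v d by case=> /qP[_ [? <-] _ _ _] <-.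
have B34 u v w d : B u v w d -> B u v d w by case=> /qP[_ _ [? ?] _ _] <-.
rewrite -[block q x y z]/[set x; y; z; q x y z]; move: (q x y z) Bxyz => w Bxyz.
have H d : B a b c d -> [set a; b; c; d] = [set x; y; z; w] ->
   T a b c /\ block q a b c = [set x; y; z; w].
  by case=> ? e <-; rewrite /block e.
clearbody B.
rewrite !inE -!orbA => /or4P[] /eqP ea /or4P[] /eqP eb /or4P[] /eqP ec;
  subst a b c; rewrite ?eqxx // in ab ac bc.
(* The fourth point is the one of [x], [y], [z], [w] that [a], [b], [c] leave out. At most six
   adjacent transpositions are needed, within the depth of [auto]. *)
all: first [apply: (H w); first solve [auto 8] | apply: (H z); first solve [auto 8]
  | apply: (H y); first solve [auto 8] | apply: (H x); first solve [auto 8]].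
all: by apply/setP => u; rewrite !inE; do 4!case: (u == _).
Qed.
End Blocks.

(** * Group designs *)

Local Notation Y := (bool * 'I_3)%type.

Definition shift (J : Type) (x : J * Y) : J * Y := (x.1, (x.2.1, x.2.2 + 1)).

(* [tri true] selects the transversal triples, [tri false] all triples of
   points that do not lie in a single group [{j} * Y]. *)
Definition tri (b : bool) (J : eqType) (x y z : J * Y) : bool :=
  if b then [&& x.1 != y.1, x.1 != z.1 & y.1 != z.1]
  else [&& x != y, x != z, y != z & ~~ ((x.1 == y.1) && (x.1 == z.1))].

Definition design (b : bool) (J : eqType) : Prop := decomposable (@shift J) (@tri b J).

Lemma tri_inj b (J J' : eqType) (f : J -> J') (x y z : J * Y) : injective f ->
  tri b (f x.1, x.2) (f y.1, y.2) (f z.1, z.2) = tri b x y z.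
Proof.
by move=> fI; rewrite /tri !xpair_eqE !(inj_eq fI) -!xpair_eqE -!surjective_pairing.
Qed.

Lemma design_bij b (J J' : finType) : #|J| = #|J'| -> design b J -> design b J'.
Proof.
move=> eJ.
pose f (j : J) : J' := enum_val (cast_ord eJ (enum_rank j)).
pose g (j : J') : J := enum_val (cast_ord (esym eJ) (enum_rank j)).
have fg : cancel g f by move=> j; rewrite /f /g enum_valK cast_ordKV enum_rankK.
have gf : cancel f g by move=> j; rewrite /f /g enum_valK cast_ordK enum_rankK.
apply: (decomposable_transport (f := fun x => (f x.1, x.2)) (g := fun x => (g x.1, x.2))).
- by move=> x y z; rewrite (tri_inj _ _ _ _ (can_inj gf)) /= !gf -!surjective_pairing.
- by move=> x y z; rewrite (tri_inj _ _ _ _ (can_inj fg)) /= !fg -!surjective_pairing.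
- by [].
Qed.

Definition tri_on b (J : eqType) (K : pred J) (x y z : J * Y) :=
  [&& tri b x y z, K x.1, K y.1 & K z.1].

(** This brings designs on different sets of groups into one point set, where they can be united. *)
Lemma design_sub b (J : finType) (K : pred J) :
  design b {j | K j} <-> decomposable (@shift J) (tri_on b K).
Proof.
(* [insubd] needs a default element of [K]; if there is none, both sides hold vacuously. *)
have [j0 Kj0|K0] := pickP K; last first.
  split=> _; exists (fun x _ _ => x); first by move=> x y z /and4P[_]; rewrite K0.
  by case=> [[j Kj]]; have := K0 j; rewrite Kj.
pose j1 : {j | K j} := Sub j0 Kj0.
pose f (x : {j | K j} * Y) : J * Y := (val x.1, x.2).
pose g (x : J * Y) : {j | K j} * Y := (insubd j1 x.1, x.2).
have gf : cancel f g by move=> [j y]; rewrite /f /g /= valKd.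
have fg x : K x.1 -> f (g x) = x by move=> Kx; rewrite /f /g /= insubdK //; case: x Kx.
have h1 x y z : tri b x y z ->
     [/\ tri_on b K (f x) (f y) (f z), g (f x) = x, g (f y) = y & g (f z) = z].
  by move=> t; rewrite !gf /tri_on (tri_inj _ _ _ _ val_inj) t /= (valP x.1) (valP y.1) (valP z.1).
have h2 x y z : tri_on b K x y z ->
     [/\ tri b (g x) (g y) (g z), f (g x) = x, f (g y) = y & f (g z) = z].
  case/and4P => t Kx Ky Kz; rewrite !fg //; split=> //.
  by rewrite -(tri_inj _ _ _ _ val_inj) -!/(f _) !fg.
by split; [apply: (decomposable_transport h1 h2)|apply: (decomposable_transport h2 h1)].
Qed.

(** * Blocks with two points in each of two parts *)

Section Pairs.
Variables (L A : eqType) (ok : pred L) (s : A -> A) (K : Type) (Qe : rel A)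
          (col : A -> A -> K) (nu : K -> A -> A).

Definition pair_tri (x y z : L * A) :=
  [&& ok x.1, ok y.1, ok z.1 &
  [|| [&& x.1 == y.1, x.1 != z.1 & Qe x.2 y.2],
      [&& x.1 == z.1, x.1 != y.1 & Qe x.2 z.2]
    | [&& y.1 == z.1, y.1 != x.1 & Qe y.2 z.2]]].

(** [col] colours the edges [Qe], and [nu k] is the matching of colour [k] written as an involution.
    Two edges of one colour in different parts form a block, so an edge and a point of another part
    determine it; the shift carries matchings to matchings. *)
Lemma pair_decomposable :
  (forall a a', Qe a a' ->
     [/\ Qe a' a, col a' a = col a a', a != a', nu (col a a') a = a'
       & forall b, [/\ Qe b (nu (col a a') b),
                       col b (nu (col a a') b) = col a a',
                       Qe (s a) (s a')
                     & nu (col (s a) (s a')) (s b) = s (nu (col a a') b)]]) ->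
  decomposable (fun x : L * A => (x.1, s x.2)) pair_tri.
Proof.
move=> H.
pose q (x y z : L * A) : L * A :=
  if x.1 == y.1 then (z.1, nu (col x.2 y.2) z.2)
  else if x.1 == z.1 then (y.1, nu (col x.2 z.2) y.2)
  else (x.1, nu (col y.2 z.2) x.2).
have symQ a a' : Qe a a' -> Qe a' a by case/H.
have symC a a' : Qe a a' -> col a' a = col a a' by case/H.
have nuK a a' b : Qe a a' -> nu (col a a') (nu (col a a') b) = b.
  move=> Q; have [_ _ _ _ /(_ b) [Qb cb _ _]] := H _ _ Q.
  by have [_ _ _ + _] := H _ _ (symQ _ _ Qb); rewrite symC // cb.
have irr a : Qe a a = false by apply/negP=> /H [_ _ /eqP].
exists q => -[l a] [m b] [n c]; rewrite /pair_tri /q /= => /and4P[ol om on].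
have [<-|lm] := eqVneq l m.
  have [<-|ln] := eqVneq l n; rewrite ?eqxx ?(eq_sym n) ?(negbTE ln) //= ?orbF ol ?om on /=.
  move=> Q; have [Q' C' ne nuab /(_ c) [Qc cc sQ sn]] := H _ _ Q.
    rewrite Q Q' C' nuK // sQ sn /=; do !split=> //.
    by rewrite !xpair_eqE eqxx.
  by rewrite xpair_eqE eqxx /=; apply/eqP => e; rewrite e irr in Qc.
have [<-|ln] := eqVneq l n; rewrite ?eqxx ?(eq_sym m l) ?(negbTE lm) /= ?orbF ol om ?on /=.
  move=> Q; have [Q' C' ne nuab /(_ b) [Qc cc sQ sn]] := H _ _ Q.
  rewrite ?(Q, Q', C', Qc, cc, nuab, sQ, sn) /=; do !split=> //.
  by rewrite xpair_eqE (negbTE lm).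
  by rewrite !xpair_eqE (eq_sym m) (negbTE lm).
have [<-|mn] := eqVneq m n; rewrite ?eqxx ?(eq_sym n) ?(negbTE lm) ?(negbTE ln) //= ?ol ?om ?on /=.
move=> Q; have [Q' C' ne nuab /(_ a) [Qc cc sQ sn]] := H _ _ Q.
rewrite ?(Q, Q', C', Qc, cc, nuab, sQ, sn) /=; do !split=> //.
  by rewrite xpair_eqE (negbTE lm).
by rewrite !xpair_eqE (negbTE lm).
Qed.
End Pairs.

Section Colouring.
Variables (L : eqType) (ok : pred L) (B : zmodType) (h : B) (okc : pred B).

(** For points in different halves this is the coordinate in the [true] half minus the one in the
    [false] half, whatever the order of the arguments. *)
Definition odd_even_diff (a a' : bool * B) := if a.1 then a.2 - a'.2 else a'.2 - a.2.

(** Chords will be coloured by sums, all other edges by differences. *)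
Definition chord (a a' : bool * B) := (a.1 == a'.1) || (a.2 == a'.2).

Definition allowed_edge (a a' : bool * B) :=
  (a != a') && (chord a a' || okc (odd_even_diff a a')).

(* The pairs [{(p, b), (p, c - b)}], completed by the pairs [{(0, b), (1, b)}] with
   [b + b = c], form a perfect matching for every [c]; the remaining pairs are sorted
   by their difference. *)
Lemma colouring_decomposable :
  decomposable (fun x : L * (bool * B) => (x.1, (x.2.1, x.2.2 + h)))
    (@pair_tri L _ ok allowed_edge).
Proof.
pose col (a a' : bool * B) : B + B :=
  if chord a a' then inl (a.2 + a'.2) else inr (odd_even_diff a a').
pose nu (k : B + B) (a : bool * B) : bool * B :=
  match k with
  | inl c => if a.2 + a.2 == c then (~~ a.1, a.2) else (a.1, c - a.2)
  | inr d => (~~ a.1, if a.1 then a.2 - d else a.2 + d)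
  end.
pose sh (a : bool * B) := (a.1, a.2 + h).
(* A shift by [h] turns the sum [c] into [c + h + h], whereas it fixes the difference colours
   treated in [nu_r]. *)
have nu_l c b : [/\ b != nu (inl c) b, chord b (nu (inl c) b), b.2 + (nu (inl c) b).2 = c
    & nu (inl (c + h + h)) (sh b) = sh (nu (inl c) b)].
  case: b => p b; rewrite /nu /chord /sh /=.
  have -> : (b + h + (b + h) == c + h + h) = (b + b == c).
    by rewrite addrACA addrA !(inj_eq (addIr h)).
  have [<-|nb] := eqVneq (b + b) c; rewrite ?xpair_eqE /= ?eqxx ?orbT.
    by split=> //; case: p.
  split=> //; first by rewrite /= eq_sym subr_eq eq_sym.
    by rewrite addrC subrK.
  by congr (_, _); rewrite opprD addrACA subrr addr0 addrAC.
have nu_r d b : d != 0 -> [/\ b != nu (inr d) b, ~~ chord b (nu (inr d) b),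
    odd_even_diff b (nu (inr d) b) = d & nu (inr d) (sh b) = sh (nu (inr d) b)].
  move=> d0; case: b => p b; rewrite /nu /chord /odd_even_diff /sh /= xpair_eqE.
  have -> : (p == ~~ p) = false by case: p.
  have nb : b != (if p then b - d else b + d).
    by case: p; rewrite -subr_eq0 ?subKr // opprD addNKr oppr_eq0.
  rewrite (negbTE nb); split=> //; first by case: p {nb}; rewrite ?subKr // addrC addKr.
  by case: p {nb}; rewrite addrAC.
apply: (@pair_decomposable L _ ok sh _ _ col nu) => a a' /andP[ne okaa].
have chC : chord a' a = chord a a' by rewrite /chord eq_sym (eq_sym a'.2).
have chS : chord (sh a) (sh a') = chord a a' by rewrite /chord /= (inj_eq (addIr h)).
have neS : sh a != sh a'.
  apply: contraNneq ne; case: a a' {okaa chC chS} => [p a] [p' a'] [-> /addIr ->].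
  by rewrite eqxx.
have dS : odd_even_diff (sh a) (sh a') = odd_even_diff a a'.
  by rewrite /odd_even_diff /=; case: ifP => _; rewrite opprD addrACA subrr addr0.
rewrite /allowed_edge /col chC chS neS (eq_sym a') ne dS okaa.
have [ch|nch] := boolP (chord a a').
  split=> //; first by rewrite addrC.
    case: a a' ne ch {okaa chC chS neS dS} => [p a] [p' a'].
    rewrite xpair_eqE /nu /chord /=; have [<-|pp] := eqVneq p p' => /= ne.
      by rewrite (inj_eq (addrI a)) (negbTE ne) addrAC subrr add0r.
    by move/eqP <-; rewrite eqxx; case: p p' pp ne => [] [].
  move=> b; have [n1 -> -> e] := nu_l (a.2 + a'.2) b.
  split=> //; first by rewrite n1.
  by rewrite -e; congr (nu (inl _) _); rewrite /= addrACA addrA.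
have /norP[n1 n2] := nch.
have d0 : odd_even_diff a a' != 0.
  by rewrite /odd_even_diff; case: ifP => _; rewrite subr_eq0 // eq_sym.
have dC : odd_even_diff a' a = odd_even_diff a a'.
  by move: n1; rewrite /odd_even_diff; case: a.1 a'.1 => [] [].
have ok' : okc (odd_even_diff a a') by move: okaa; rewrite (negbTE nch).
rewrite dC ok'; split=> //.
  case: a a' {ne chC chS neS dS okaa ok' d0 dC nch n2} n1 => [p a] [p' a'] /=.
  by rewrite /odd_even_diff /nu /=; case: p p' => [] [] // _; rewrite ?subKr // addrC subrK.
move=> b; have [m1 m2 -> e] := nu_r _ b d0.
by rewrite m1 (negbTE m2) ok' e.
Qed.
End Colouring.

(** * Blocks meeting four parts, and blocks of type 2 + 1 + 1 *)

Local Notation label := (bool * bool)%type.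
Definition lab0 : label := (false, false).
Definition ladd (l m : label) : label := (l.1 (+) m.1, l.2 (+) m.2).

Lemma ladd4K l m n : ladd l (ladd m (ladd l (ladd m n))) = n.
Proof. by move: l m n => [[] []] [[] []] [[] []]. Qed.

(** The four elements of the Klein group sum to zero, so three distinct ones add up to the missing
    one. *)
Lemma ladd3_neq (l m n : label) : l != m -> l != n -> m != n ->
  [/\ ladd l (ladd m n) != l, ladd l (ladd m n) != m & ladd l (ladd m n) != n].
Proof. by move: l m n => [[] []] [[] []] [[] []]. Qed.

Section Transversal4.
Variables (A : eqType) (s : A -> A) (G : zmodType) (F : label -> A -> G)
  (F' : label -> G -> A) (e : label -> G) (ok : label -> pred A).

Definition fourth (x y z : label * A) : label * A :=
  let l := ladd x.1 (ladd y.1 z.1) in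
  (l, F' l (- (F x.1 x.2 + F y.1 y.2 + F z.1 z.2))).

Definition transversal4 (x y z : label * A) :=
  let w := fourth x y z in
  [&& x.1 != y.1, x.1 != z.1, y.1 != z.1, ok x.1 x.2, ok y.1 y.2, ok z.1 z.2 & ok w.1 w.2].

(** Blocks are the transversals of the four parts whose [F]-coordinates sum to zero, so three points
    determine the fourth. The shift adds [e l] in part [l], and these increments cancel over the
    four parts. *)
Lemma transversal4_decomposable :
  (forall l, cancel (F l) (F' l)) -> (forall l, cancel (F' l) (F l)) ->
  (forall l a, F l (s a) = F l a + e l) -> (forall l a, ok l (s a) = ok l a) ->
  (forall l m n, l != m -> l != n -> m != n ->
     e l + e m + e n + e (ladd l (ladd m n)) = 0) ->
  decomposable (fun x => (x.1, s x.2)) transversal4.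
Proof.
move=> FK F'K Fs oks e0; exists fourth => -[l a] [m b] [n c].
have sum3 (u v w : G) : u + v - (u + v + w) = - w by rewrite opprD addrA subrr add0r.
have q12 : fourth (m, b) (l, a) (n, c) = fourth (l, a) (m, b) (n, c).
  by rewrite /fourth /ladd /= !addbA (addbC m.1) (addbC m.2) (addrC (F m b)).
have q23 : fourth (l, a) (n, c) (m, b) = fourth (l, a) (m, b) (n, c).
  by rewrite /fourth /ladd /= (addbC n.1) (addbC n.2) addrAC.
have qq : fourth (l, a) (m, b) (fourth (l, a) (m, b) (n, c)) = (n, c).
  by rewrite /fourth /= F'K sum3 opprK ladd4K FK.
rewrite /transversal4 q12 q23 qq /=.
case/and4P=> lm ln mn /and4P[ol om on ow].
have [kl km kn] := ladd3_neq lm ln mn.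
have se : s (fourth (l, a) (m, b) (n, c)).2 = (fourth (l, s a) (m, s b) (n, s c)).2.
  set k := ladd l (ladd m n).
  rewrite /fourth /= -/k; apply: (can_inj (FK k)); rewrite Fs !F'K !Fs.
  have -> : e k = - (e l + e m + e n) by apply/eqP; rewrite -addr_eq0 addrC e0.
  by rewrite -opprD; congr (- _); rewrite addrACA (addrACA (F l a)).
split; split=> //.
- by rewrite eq_sym lm ln mn ol om on ow.
- by rewrite (eq_sym n) lm ln mn ol om on ow.
- by rewrite lm ol om on ow (eq_sym l) kl (eq_sym m) km.
- by rewrite lm ln mn !oks ol om on; move: ow; rewrite -oks se.
- by rewrite se.
- by rewrite xpair_eqE (negbTE lm).
- by rewrite /fourth xpair_eqE /= (negbTE kn).
Qed.
End Transversal4.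

Section Mixed.
Variables (G : zmodType) (h : G) (pe : pred G) (tail : label -> G -> G)
  (PS : pred G) (lab : G -> label) (delta : G -> G).

Definition Pe (g g' : G) := pe (g' - g) || pe (g - g').

Definition pick (i : label) (x y z : label * G) :=
  if x.1 == i then x.2 else if y.1 == i then y.2 else z.2.

Definition mixed (x y z : label * G) :=
  [&& x.1 != lab0, y.1 != lab0, z.1 != lab0 &
  [|| [&& x.1 != y.1, x.1 != z.1, y.1 != z.1 & PS (x.2 + y.2 + z.2)],
      [&& x.1 == y.1, x.1 != z.1 & Pe x.2 y.2],
      [&& x.1 == z.1, x.1 != y.1 & Pe x.2 z.2]
    | [&& y.1 == z.1, y.1 != x.1 & Pe y.2 z.2]]].

(* The common value of [b + c] over the blocks [{a, a', b, c}] doubling the label [i]. *)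
Definition Psi i g g' :=
  if pe (g' - g) then tail i (g' - g) - g else tail i (g - g') - g'.

Definition mixed_map (x y z : label * G) : label * G :=
  if x.1 == y.1 then (ladd x.1 z.1, Psi x.1 x.2 y.2 - z.2)
  else if x.1 == z.1 then (ladd x.1 y.1, Psi x.1 x.2 z.2 - y.2)
  else if y.1 == z.1 then (ladd x.1 y.1, Psi y.1 y.2 z.2 - x.2)
  else let S := x.2 + y.2 + z.2 in (lab S, pick (lab S) x y z + delta S).

(** A block joins two points [g], [g'] of part [i] to one point of each other nonzero part. If
    [e = g' - g] satisfies [pe], its two transversal triples have sums [tail i e] and
    [tail i e + e]. Each sum [S] in [PS] arises from exactly one such [i] and [e], so a transversal
    triple tells which part to double, [lab S], and by which step, [delta S]. Shifts preserve the
    sum because [h + h + h = 0]. *)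
Lemma mixed_decomposable :
  h + h + h = 0 ->
  (forall S, PS S -> lab S != lab0 /\
     (pe (delta S) && (tail (lab S) (delta S) == S) ||
      pe (- delta S) && (tail (lab S) (- delta S) == S + delta S))) ->
  (forall i e, pe e -> i != lab0 ->
     [/\ PS (tail i e), lab (tail i e) = i & delta (tail i e) = e] /\
     [/\ PS (tail i e + e), lab (tail i e + e) = i & delta (tail i e + e) = - e]) ->
  (forall e, pe e -> ~~ pe (- e)) ->
  decomposable (fun x : label * G => (x.1, x.2 + h)) mixed.
Proof.
move=> h3 HS Hpe asym.
have PeC g g' : Pe g' g = Pe g g' by rewrite /Pe orbC.
have PsiC i g g' : Pe g g' -> Psi i g' g = Psi i g g'.
  rewrite /Pe /Psi -(opprB g' g); have [p _|np] /= := boolP (pe (g' - g)).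
    by rewrite (negbTE (asym _ p)).
  by move=> ->.
have PeI g g' : Pe g g' -> g != g'.
  apply: contraTneq => ->; rewrite /Pe subrr orbb; apply/negP => p.
  by have := asym _ p; rewrite oppr0 p.
have PsiP i g g' : Pe g g' -> i != lab0 ->
    [/\ PS (Psi i g g' + g), lab (Psi i g g' + g) = i & delta (Psi i g g' + g) = g' - g].
  rewrite /Pe /Psi => + i0; case: ifP => [p _|_ /= p].
    by have [] := Hpe i _ p i0; rewrite subrK.
  by have [_] := Hpe i _ p i0; rewrite -addrA (addrC (- g')) opprB.
have PsiD S g : PS S -> Pe g (g + delta S) /\ Psi (lab S) g (g + delta S) = S - g.
  move=> /HS [i0]; rewrite /Pe /Psi.
  have -> : g + delta S - g = delta S by rewrite addrAC subrr add0r.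
  have -> : g - (g + delta S) = - delta S by rewrite opprD addrA subrr add0r.
  case/orP=> /andP[p /eqP e]; rewrite p ?orbT; first by rewrite e.
  have np : ~~ pe (delta S) by rewrite -[delta S]opprK asym.
  by rewrite (negbTE np) e (addrC g) opprD addrA addrK.
have PeS g g' : Pe (g + h) (g' + h) = Pe g g'.
  by rewrite /Pe !opprD !(addrACA _ h) !subrr !addr0.
have PsiS i g g' : Psi i (g + h) (g' + h) = Psi i g g' - h.
  by rewrite /Psi !opprD !(addrACA _ h) !subrr !addr0 !addrA; case: ifP.
have hh : - h - h = h by apply/eqP; rewrite -opprD eq_sym -addr_eq0 addrA h3.
have laddK (l m : label) : ladd l (ladd l m) = m by move: l m => [[] []] [[] []].
have laddC (l m : label) : ladd l m = ladd m l by move: l m => [[] []] [[] []].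
have ladd_n (l m : label) : l != lab0 -> m != lab0 -> l != m ->
    [/\ ladd l m != l, ladd l m != m & ladd l m != lab0].
  by move: l m => [[] []] [[] []].
have ladd_d (l m n : label) : l != lab0 -> m != lab0 -> n != lab0 -> l != m -> l != n ->
    m != n -> ladd l m = n.
  by move: l m n => [[] []] [[] []] [[] []].
exists mixed_map => -[l a] [m b] [n c]; rewrite /mixed /mixed_map /pick /=.
case/and4P=> l0 m0 n0; have [lm|lm] := eqVneq l m.
  subst m; have [//|ln] := eqVneq l n; rewrite /= orbF => P.
  have [k1 k2 k3] := ladd_n _ _ l0 n0 ln.
  have k1' : (l == ladd l n) = false by rewrite eq_sym (negbTE k1).
  rewrite l0 n0 k3 k1' PeS (PeC a b) P /= laddK subKr PsiC // PsiS; split; split=> //.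
  - by rewrite opprD addrACA hh.
  - by rewrite xpair_eqE eqxx PeI.
  - by rewrite xpair_eqE (negbTE k2).
have [ln|ln] := eqVneq l n.
  subst n; rewrite ![m == l]eq_sym (negbTE lm) /= !orbF => P.
  have [k1 k2 k3] := ladd_n _ _ l0 m0 lm.
  have [P1 P2 P3] := PsiP l _ _ P l0.
  have ES : a + b + (Psi l a c - b) = Psi l a c + a.
    by rewrite addrC -addrA (addrC a) addKr.
  have k1' : (l == ladd l m) = false by rewrite eq_sym (negbTE k1).
  have k2' : (m == ladd l m) = false by rewrite eq_sym (negbTE k2).
  rewrite l0 m0 k3 k1' k2' ES P1 P2 P3 PeS P ?eqxx /= ?orbT.
  rewrite PsiS (laddC m); split; split=> //.
  - by rewrite addrC subrK.
  - by rewrite opprD addrACA hh.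
  - by rewrite xpair_eqE (negbTE lm).
  - by rewrite xpair_eqE (negbTE k1).
have [mn|mn] := eqVneq m n.
  subst n; rewrite /= => P.
  have [k1 k2 k3] := ladd_n _ _ l0 m0 lm.
  have [P1 P2 P3] := PsiP m _ _ P m0.
  have ES : a + b + (Psi m b c - a) = Psi m b c + b.
    by rewrite addrC -addrA addKr.
  have k1' : (l == ladd l m) = false by rewrite eq_sym (negbTE k1).
  have k2' : (m == ladd l m) = false by rewrite eq_sym (negbTE k2).
  rewrite l0 m0 k3 k1' k2' ES P1 P2 P3 PeS (PeC b c) P (negbTE lm) ?eqxx /= ?orbT.
  rewrite PsiS (PsiC m _ _ P) (laddC m l); split; split=> //.
  - by rewrite addrC subrK.
  - by rewrite opprD addrACA hh.
  - by rewrite xpair_eqE (negbTE lm).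
  - by rewrite xpair_eqE (negbTE k2).
rewrite /= orbF => P; set S := a + b + c in P *.
have [i0 _] := HS _ P.
have E1 : b + a + c = S by rewrite /S (addrC b).
have E2 : a + c + b = S by rewrite addrAC.
have E3 : a + h + (b + h) + (c + h) = S.
  by rewrite (addrACA a) (addrACA (a + b)) h3 addr0.
have [Pa Psa] := PsiD S a P; have [Pb Psb] := PsiD S b P; have [Pc Psc] := PsiD S c P.
have dn := ladd_d _ _ _ l0 m0 n0 lm ln mn.
rewrite l0 m0 n0 E1 E2 E3 P /=.
have [il|nil] := eqVneq l (lab S).
  rewrite -il in Psa i0 *; rewrite [m == l]eq_sym (negbTE lm) l0 Pa Psa /=.
  split; split=> //.
  - by rewrite dn -addrA -opprD /S (addrC (a + b)) addrK.
  - by rewrite addrAC.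
  - by rewrite xpair_eqE (negbTE lm).
  - by rewrite xpair_eqE (negbTE ln).
have [im|nim] := eqVneq m (lab S).
  rewrite -im in Psb i0 *; rewrite [n == m]eq_sym (negbTE mn) m0 Pb Psb /=.
  split; split=> //.
  - by rewrite dn -addrA -opprD /S (addrC b) (addrC (a + b)) addrK.
  - by rewrite addrAC.
  - by rewrite xpair_eqE (negbTE lm).
  - by rewrite xpair_eqE (negbTE mn).
have il : n = lab S by rewrite -dn; apply: ladd_d.
rewrite -il in Psc i0 *.
(* Replacing the third point by the fourth gives the other transversal triple of the block; its sum
   prescribes the step back. *)
have [Q1 Q2 Q3] : [/\ PS (S + delta S), lab (S + delta S) = n & delta (S + delta S) = - delta S].
  have Pc' : Pe (c + delta S) c by rewrite PeC.
  have [] := PsiP n _ _ Pc' n0; rewrite PsiC // Psc addrA subrK.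
  by rewrite opprD addrA subrr add0r.
have E4 : a + b + (c + delta S) = S + delta S by rewrite addrA.
rewrite eqxx E4 Q1 Q2 Q3 (negbTE ln) (negbTE mn) n0 /= addrK.
split; split=> //.
- by rewrite addrAC.
- by rewrite xpair_eqE (negbTE lm).
- rewrite xpair_eqE eqxx /=; apply/eqP => e; move: (PeI _ _ Pc).
  by rewrite e eqxx.
Qed.
End Mixed.

(** * Tripling *)

Lemma Z3_add1_neq (x : 'I_3) : x + 1 != x.
Proof. by case: x => [[|[|[|]]]]. Qed.

(** * Arithmetic of rows modulo [2 (n + 1)] *)

Section Rows.
Variables (n : nat).
Notation I := 'I_n.+1.
Notation R := 'I_(n.*2).+2.

(** [inc] merely includes representatives, whereas [dbl] is a group morphism from integers modulo
    [n + 1] to integers modulo [2 (n + 1)]. *)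
Definition inc (t : I) : R := inZp t.
Definition dbl (t : I) : R := inZp (t.*2).
Definition halfr (d : R) : I := inZp (d./2).

Lemma val_inc t : inc t = t :> nat.
Proof. by rewrite /= modn_small //; case: t => /= t; lia. Qed.

Lemma val_dbl t : dbl t = t.*2 :> nat.
Proof. by rewrite /= modn_small //; case: t => /= t; lia. Qed.

Lemma val_dbl1 t : (dbl t + 1)%R = t.*2.+1 :> nat.
Proof.
rewrite /= modnDml modn_small //; first by rewrite modn_small // addn1.
by case: t => /= t; rewrite modn_small //; lia.
Qed.

Lemma dblE t : dbl t = inc t + inc t.
Proof. by apply: val_inj => /=; rewrite modnDm addnn. Qed.

Lemma dblD : {morph dbl : a b / a + b}.
Proof.
move=> a b; apply: val_inj => /=; rewrite modnDm -doubleD -!mul2n.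
have -> : ((2 * n).+2 = 2 * n.+1)%N by rewrite mulnS.
by rewrite -!muln_modr modn_mod.
Qed.

Lemma dblN a : dbl (- a) = - dbl a.
Proof.
apply/eqP; rewrite -addr_eq0 -dblD addNr; apply/eqP; exact: val_inj.
Qed.

Lemma dbl_one : dbl (inZp 1) = 1 + 1.
Proof.
apply: val_inj => /=; rewrite -!mul2n.
have -> : ((2 * n).+2 = 2 * n.+1)%N by rewrite mulnS.
by rewrite modnDm addnn -!mul2n -!muln_modr modn_mod.
Qed.

Lemma val_halfr (d : R) : halfr d = d./2 :> nat.
Proof. by rewrite /= modn_small //; have := ltn_ord d; lia. Qed.

Lemma halfr_dbl1 t : halfr (dbl t + 1) = t.
Proof. by apply: ord_inj; rewrite val_halfr val_dbl1 /= uphalf_double. Qed.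

Lemma halfr_dbl t : halfr (dbl t) = t.
Proof. by apply: ord_inj; rewrite val_halfr val_dbl doubleK. Qed.

Lemma dbl_halfr (d : R) : dbl (halfr d) + (if odd d then 1 else 0) = d.
Proof.
apply: ord_inj; have := odd_double_half d.
by case: ifP => od; rewrite ?addr0 ?val_dbl1 ?val_dbl val_halfr.
Qed.

(* Every row sum is [- t] (a tail) or [t + 1] (a head) for exactly one [t]. *)
Definition tside (s : R) := (s == 0 :> nat) || (n.+1 < s)%N.
Definition tidx (s : R) : I := if tside s then inZp (- s : R)%R else inZp (s.-1).

Lemma val_oppR (x : R) : (- x)%R = (((n.*2).+2 - x) %% (n.*2).+2)%N :> nat.
Proof. by []. Qed.

Lemma val_inZpI m : (inZp m : I) = (m %% n.+1)%N :> nat.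
Proof. by []. Qed.

Lemma tside_tail t : tside (- inc t).
Proof.
rewrite /tside val_oppR val_inc; have := ltn_ord t; case: (nat_of_ord t) => [|m] lt.
  by rewrite subn0 modnn.
by rewrite modn_small; lia.
Qed.

Lemma tidx_tail t : tidx (- inc t) = t.
Proof. by apply: ord_inj; rewrite /tidx tside_tail opprK val_inZpI val_inc modn_small. Qed.

Lemma val_inc1 t : (inc t + 1)%R = t.+1 :> nat.
Proof.
have := ltn_ord t => lt.
by rewrite /= modnDm addn1 modn_small //; lia.
Qed.

Lemma tside_head t : tside (inc t + 1) = false.
Proof. by rewrite /tside val_inc1; have := ltn_ord t; lia. Qed.

Lemma tidx_head t : tidx (inc t + 1) = t.
Proof. by apply: ord_inj; rewrite /tidx tside_head val_inc1 val_inZpI modn_small ?ltn_ord. Qed.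

Lemma tsideP s : s = if tside s then - inc (tidx s) else inc (tidx s) + 1.
Proof.
rewrite /tidx; have [ts|ts] := boolP (tside s); apply: ord_inj.
  rewrite -[in LHS](opprK s); congr (nat_of_ord (- _)); apply: ord_inj.
  rewrite val_inc val_inZpI modn_small //.
  move: ts; rewrite /tside => /orP[/eqP s0|s1]; first by rewrite /= s0 subn0 modnn.
  by rewrite /= modn_small; have := ltn_ord s; lia.
by rewrite val_inc1 val_inZpI modn_small; move: ts; rewrite /tside; have := ltn_ord s; lia.
Qed.

(** Both sides single out the row sums 0 and 1, which are the tail and the head of index 0. Hence
    the sums withheld from mixed blocks are exactly those completed by a row of the extra group. *)
Lemma halfr_eq0 (s : R) : (halfr s == 0) = (tidx s == 0).
Proof.
have /= ls := ltn_ord s.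
rewrite /tidx /tside -!val_eqE /= modn_small; last by lia.
case: ifP => ts /=.
  have [->|s0] := eqVneq (nat_of_ord s) 0%N; first by rewrite subn0 modnn mod0n.
  by rewrite (@modn_small (_ - _)) ?modn_small; lia.
by rewrite modn_small; lia.
Qed.
End Rows.

(** An enumeration of the nonzero labels, inverted by [ul]; the value of [ul] at [lab0] is
    arbitrary. *)
Definition lb (i : 'I_3) : label := (i != 0, i != 1).
Definition ul (l : label) : 'I_3 := if l.1 then (if l.2 then 1 + 1 else 1) else 0.

Lemma lbK : cancel lb ul.
Proof. by case=> [[|[|[|]]]] //= p; apply: val_inj. Qed.

Lemma ulK l : l != lab0 -> lb (ul l) = l.
Proof. by case: l => [[] []]. Qed.

Lemma lb_neq0 i : lb i != lab0.
Proof. by case: i => [[|[|[|]]]]. Qed.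

(* Three copies of [I * Y], labelled by the nonzero elements of the Klein group, and, when
   [r] holds, a common extra group with label [lab0]. The point [(j, (p, a))] is in row
   [2 j + p] of [Z_(2k)]. Transversal triples are sorted by their sum in [Z_(2k) * Z_3]:
   the sums [(- t, i)] and [(t + 1, i + 1)] differ by [(2 t + 1, 1)], and the two triples
   obtained by this change in the part labelled [lb i] are joined in one block. If [r] holds,
   the sums with [t = 0] are instead completed by a point of the extra group. The pairs of
   points in one part not used in this way have a colouring by perfect matchings. *)
Section Tripling.
Variables (n : nat) (r : bool).
Notation I := 'I_n.+1.
Notation R := 'I_(n.*2).+2.
Notation G := (R * 'I_3)%type.

Definition okt (t : I) := ~~ r || (t != 0).
Definition pe (e : G) := [&& e.2 == 1, odd e.1 & okt (halfr e.1)].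
Definition tail (l : label) (e : G) : G := (- inc (halfr e.1), ul l).
Definition PS (S : G) := okt (tidx S.1).
Definition lab (S : G) := lb (if tside S.1 then S.2 else S.2 - 1).
Definition delta (S : G) : G :=
  let d : G := (dbl (tidx S.1) + 1, 1) in if tside S.1 then d else - d.

Lemma triple_mixed_decomposable :
  decomposable (fun x : label * G => (x.1, x.2 + (0, 1))) (mixed pe PS).
Proof.
apply: (@mixed_decomposable _ _ pe tail PS lab delta).
- by congr (_, _); apply: val_inj.
- move=> [s t] ok; split; first exact: lb_neq0.
  set d : G := (dbl (tidx s) + 1, 1).
  have pd : pe d by rewrite /pe eqxx val_dbl1 /= odd_double halfr_dbl1.
  have tl l : tail l d = (- inc (tidx s), ul l) by rewrite /tail halfr_dbl1.
  (* The head [inc t + 1] exceeds the tail [- inc t] by [dbl t + 1], the first coordinate of [d]. *)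
  have sE := tsideP s; rewrite /lab /delta -/d.
  case: (boolP (tside s)) sE => ts sE; apply/orP; [left|right].
    by rewrite pd tl lbK -sE /=.
  rewrite opprK pd tl lbK /=; apply/eqP; congr (_, _).
  rewrite -[RHS]/(s - (dbl (tidx s) + 1)) [X in X - _]sE dblE.
  by rewrite opprD addrACA subrr addr0 opprD addrA subrr add0r.
- move=> l [d t] /and3P[/= /eqP -> od ok] l0.
  have dE : dbl (halfr d) + 1 = d by rewrite -[RHS]dbl_halfr od.
  rewrite /tail /PS /lab /delta /=; split.
    by rewrite tside_tail tidx_tail ulK // dE.
  have -> : - inc (halfr d) + d = inc (halfr d) + 1 by rewrite -{2}dE dblE -addrA addKr.
  by rewrite tside_head tidx_head ok addrK ulK // dE.
(* In the column coordinate, 1 differs from its opposite modulo 3. *)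
- by move=> [d t] /and3P[/= /eqP -> _ _]; rewrite /pe.
Qed.

Definition row (a : I * Y) : G := (dbl a.1 + (if a.2.1 then 1 else 0), a.2.2).
Definition unrow (g : G) : I * Y := (halfr g.1, (odd g.1, g.2)).

Lemma rowK : cancel row unrow.
Proof.
move=> [j [[] a]]; congr (_, (_, _)).
- exact: halfr_dbl1.
- by rewrite -[LHS]/(odd (dbl j + 1)%R) val_dbl1 /= odd_double.
- by rewrite -[LHS]/(halfr (dbl j + 0)) addr0 halfr_dbl.
- by rewrite -[LHS]/(odd (dbl j + 0)%R) addr0 val_dbl odd_double.
Qed.

Lemma unrowK : cancel unrow row.
Proof. by move=> [y a]; rewrite /row /unrow /= dbl_halfr. Qed.

(** Column signs are positive on two labels and negative on two, so that the common shift cancels.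
    Row signs are negative on [lab0] only, so the row of the extra point is the sum of the other
    three rows. *)
Definition sflip (l : label) (g : G) : G :=
  if l == lab0 then - g else if l == (true, true) then (g.1, - g.2) else g.

Lemma sflipK l : involutive (sflip l).
Proof.
move=> [y a]; rewrite /sflip; case: (l == lab0); first by rewrite opprK.
by case: (l == _) => //=; rewrite opprK.
Qed.

Definition stem_ok (l : label) (a : I * Y) := (l != lab0) || (r && (a.1 == 0)).

Definition stem_tri := transversal4 (fun l a => sflip l (row a))
  (fun l g => unrow (sflip l g)) stem_ok.

Lemma triple_stem_decomposable :
  decomposable (fun x : label * (I * Y) => (x.1, shift x.2)) stem_tri.
Proof.
pose e (l : label) : G := if (l == lab0) || (l == (true, true)) then (0, -1) else (0, 1).
apply: (@transversal4_decomposable _ _ _ _ _ e).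
- by move=> l a; rewrite sflipK rowK.
- by move=> l g; rewrite unrowK sflipK.
- move=> l [j [p a]]; rewrite /sflip /row /shift /e /=.
  move: (dbl j + _) => y.
  case: (l == lab0); first by rewrite -[LHS]/(- y, - (a + 1)) -[RHS]/(- y + 0, - a - 1) addr0 opprD.
  case: (l == _); first by rewrite -[RHS]/(y + 0, - a - 1) addr0 opprD.
  by rewrite -[RHS]/(y + 0, a + 1) addr0.
- by move=> l [j y].
- by move=> [[] []] [[] []] [[] []] //= _ _ _; congr (_, _); apply: val_inj.
Qed.

(** The differences not consumed by [pe]. From the even to the odd row the row difference is
    [2 d.1 + 1]; read backwards it is [2 (- d.1 - 1) + 1], whence the second test. *)
Definition okc (d : I * 'I_3) :=
  ~~ ((d.2 == 1) && okt d.1 || (d.2 == -1) && okt (- d.1 - inZp 1)).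

Definition split_pt (a : I * Y) : bool * (I * 'I_3) := (a.2.1, (a.1, a.2.2)).

Lemma pe_row (j j' : I) (p p' : bool) (a a' : 'I_3) :
  pe (row (j', (p', a')) - row (j, (p, a))) =
  [&& a' - a == 1, p != p' & okt (j' - j - (if p then inZp 1 else 0))].
Proof.
rewrite -[row _ - row _]/(dbl j' + (if p' then 1 else 0) - (dbl j + (if p then 1 else 0)), a' - a).
rewrite opprD addrACA -dblN -dblD /pe; congr (_ && _).
have E t : odd (dbl t + 1)%R && okt (halfr (dbl t + 1)) = okt t.
  by rewrite halfr_dbl1 val_dbl1 /= odd_double.
have E0 t : odd (dbl t + 0)%R = false by rewrite addr0 val_dbl odd_double.
case: p p' => [] [].
- by rewrite -[(_, _).1]/(dbl (j' - j) + (1 - 1)) subrr E0.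
- rewrite -[(_, _).1]/(dbl (j' - j) + (0 - 1)) -[RHS]/(okt (j' - j - inZp 1)).
  have -> : dbl (j' - j) + (0 - 1) = dbl (j' - j - inZp 1) + 1.
    by rewrite add0r (dblD (_ - _)) dblN dbl_one opprD addrA subrK.
  exact: E.
- rewrite -[(_, _).1]/(dbl (j' - j) + (1 - 0)) subr0 -[RHS]/(okt (j' - j - 0)) subr0; exact: E.
- by rewrite -[(_, _).1]/(dbl (j' - j) + (0 - 0)) subr0 E0.
Qed.

(** Chords never satisfy [Pe]: their row difference is even or their columns agree. For the other
    pairs [okc] is the negation of [pe] in either direction. *)
Lemma edge_dichotomy a a' :
  a != a' -> allowed_edge okc (split_pt a) (split_pt a') = ~~ Pe pe (row a) (row a').
Proof.
move: a a' => [j [p a]] [j' [p' a']] ne.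
have ne' : split_pt (j, (p, a)) != split_pt (j', (p', a')).
  by apply: contraNneq ne => -[-> -> ->].
have opp1 (x y : 'I_3) : (x - y == -1) = (y - x == 1) by rewrite -(opprB y) eqr_opp.
rewrite /allowed_edge ne' /chord /odd_even_diff /Pe !pe_row /split_pt /okc /= (eq_sym p').
have [-> /=|pp] := eqVneq p p'; first by rewrite !andbF.
have [[-> ->]|_] /= := eqVneq (j, a) (j', a').
  by rewrite !subrr /=.
by case: p p' pp {ne ne'} => [] [] // _ /=; rewrite ?subr0 ?opp1 ?opprB // orbC.
Qed.

(** * Assembling the three arms *)

Notation M := ((label * I) * Y)%type.
Definition assoc (x : M) : label * (I * Y) := (x.1.1, (x.1.2, x.2)).

Definition stem_part (x y z : M) := stem_tri (assoc x) (assoc y) (assoc z).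

Definition mixed_part (x y z : M) :=
  let g x := ((assoc x).1, row (assoc x).2) in mixed pe PS (g x) (g y) (g z).

Definition pair_part (x y z : M) :=
  let g x := ((assoc x).1, split_pt (assoc x).2) in
  pair_tri (predC1 lab0) (allowed_edge okc) (g x) (g y) (g z).

Lemma stem_part_decomposable : decomposable (@shift (label * I)) stem_part.
Proof.
have fP x y z : stem_tri x y z ->
    [/\ stem_part ((x.1, x.2.1), x.2.2) ((y.1, y.2.1), y.2.2) ((z.1, z.2.1), z.2.2),
      assoc ((x.1, x.2.1), x.2.2) = x, assoc ((y.1, y.2.1), y.2.2) = y
     & assoc ((z.1, z.2.1), z.2.2) = z].
  by case: x y z => [l [j b]] [l' [j' b']] [l'' [j'' b'']].
apply: (decomposable_transport fP _ _ triple_stem_decomposable) => //.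
by move=> [[l j] b] [[l' j'] b'] [[l'' j''] b''].
Qed.

Lemma mixed_part_decomposable : decomposable (@shift (label * I)) mixed_part.
Proof.
pose f (x : label * G) : M := ((x.1, (unrow x.2).1), (unrow x.2).2).
pose g (x : M) := ((assoc x).1, row (assoc x).2).
have gf x : g (f x) = x.
  case: x => l e; rewrite -[LHS]/(l, row ((unrow e).1, (unrow e).2)).
  by rewrite -surjective_pairing unrowK.
have fg x : f (g x) = x by case: x => [[l j] b]; rewrite /f /g /assoc rowK.
apply: (decomposable_transport (f := f) (g := g) _ _ _ triple_mixed_decomposable).
- by move=> x y z; rewrite /mixed_part -!/(g _) !gf.
- by move=> x y z; rewrite !fg.
- move=> [l [y a]]; rewrite -[(l, (y, a)).2 + _]/(y + 0, a + 1) addr0.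
  by rewrite /f /shift /unrow.
Qed.

Lemma pair_part_decomposable : decomposable (@shift (label * I)) pair_part.
Proof.
pose f (x : label * (bool * (I * 'I_3))) : M := ((x.1, x.2.2.1), (x.2.1, x.2.2.2)).
pose g (x : M) := ((assoc x).1, split_pt (assoc x).2).
have gf x : g (f x) = x by case: x => [l [p [j a]]].
have fg x : f (g x) = x by case: x => [[l j] [p a]].
apply: (decomposable_transport (f := f) (g := g) _ _ _
  (colouring_decomposable (predC1 lab0) (0, 1) okc)).
- by move=> x y z; rewrite /pair_part -!/(g _) !gf.
- by move=> x y z; rewrite !fg.
- move=> [l [p [j a]]].
  by rewrite -[(l, (p, (j, a))).2.2 + _]/(j + 0, a + 1) addr0.
Qed.

Definition valid (l : label * I) := (l.1 != lab0) || (r && (l.2 == 0)).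
Definition arm (c : label) (l : label * I) := (l.1 == c) || [&& l.1 == lab0, r & l.2 == 0].

Lemma Pe_irr g : Pe pe g g = false.
Proof. by rewrite /Pe subrr. Qed.

Lemma edge_cases (c : label) (i i' : I) (b b' : Y) : ((c, i, b) != (c, i', b')) =
  Pe pe (row (i, b)) (row (i', b')) || allowed_edge okc (split_pt (i, b)) (split_pt (i', b')).
Proof.
rewrite !xpair_eqE eqxx /=; have [e|ne] := eqVneq (i, b) (i', b').
  case: e => -> ->; rewrite !eqxx Pe_irr /=.
  by rewrite /allowed_edge eqxx.
by rewrite (edge_dichotomy ne) orbN -xpair_eqE ne.
Qed.

Lemma edge_excl (i i' : I) (b b' : Y) :
  allowed_edge okc (split_pt (i, b)) (split_pt (i', b')) ->
  Pe pe (row (i, b)) (row (i', b')) = false.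
Proof.
have [[-> ->]|ne] := eqVneq (i, b) (i', b'); first by rewrite Pe_irr.
by rewrite (edge_dichotomy ne) => /negbTE.
Qed.

(** One of the two opposites comes from [fourth], the other from [sflip] at [lab0]. *)
Lemma PS_stem (g g' g'' : G) :
  PS (g + g' + g'') = ~~ (r && (halfr (- - (g.1 + g'.1 + g''.1)) == 0)).
Proof. by rewrite opprK halfr_eq0 negb_and. Qed.

(** For three distinct nonzero labels the row sum decides between stem and mixed. An extra point
    with two different parts is stem. Two points of one part with one of another nonzero part are
    mixed or pair by [edge_cases]. What remains lies in one arm, that is, a part together with the
    extra group. *)
Lemma triple_parts (x y z : M) : tri_on false valid x y z =
  [|| stem_part x y z, mixed_part x y z, pair_part x y z,
      tri_on false (arm (lb 0)) x y z, tri_on false (arm (lb 1)) x y z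
    | tri_on false (arm (lb (-1))) x y z].
Proof.
move: x y z => [[l j] a] [[m j'] a'] [[k j''] a''].
rewrite /stem_part /mixed_part /pair_part /tri_on /tri /valid /arm /assoc /=.
move: l m k => [[] []] [[] []] [[] []]; rewrite /stem_tri /transversal4 /mixed /pair_tri /stem_ok /=.
all: rewrite ?andbF ?andbT ?orbF ?orbT //= ?edge_cases // ?PS_stem ?orbN // !orbb //.
Qed.

Lemma stem_mixed_disjoint x y z : stem_part x y z -> mixed_part x y z -> false.
Proof.
move: x y z => [[l j] a] [[m j'] a'] [[k j''] a''].
rewrite /stem_part /mixed_part /assoc /=.
move: l m k => [[] []] [[] []] [[] []]; rewrite /stem_tri /transversal4 /mixed /stem_ok /= ?andbF //.
all: by rewrite ?orbF PS_stem /= => ->.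
Qed.

Lemma cross_pair_disjoint x y z :
  stem_part x y z || mixed_part x y z -> pair_part x y z -> false.
Proof.
move: x y z => [[l j] a] [[m j'] a'] [[k j''] a''].
rewrite /stem_part /mixed_part /pair_part /assoc /=.
move: l m k => [[] []] [[] []] [[] []];
  rewrite /stem_tri /transversal4 /mixed /pair_tri /= ?andbF //= ?orbF.
all: by move=> h /edge_excl; rewrite h.
Qed.

Lemma cross_arm_disjoint i x y z :
  [|| stem_part x y z, mixed_part x y z | pair_part x y z] ->
  tri_on false (arm (lb i)) x y z -> false.
Proof.
move: x y z => [[l j] a] [[m j'] a'] [[k j''] a''] h /and4P[_].
move: h; rewrite /stem_part /mixed_part /pair_part /arm /assoc /=.
move: (lb i) (lb_neq0 i) => c.
by move: l m k c => [[] []] [[] []] [[] []] [[] []];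
  rewrite /stem_tri /transversal4 /mixed /pair_tri /= ?andbF.
Qed.

(** Two arms share only the extra group, and no triple of [tri false] lies inside a group. *)
Lemma arm_disjoint i i' x y z : i != i' ->
  tri_on false (arm (lb i)) x y z -> tri_on false (arm (lb i')) x y z -> false.
Proof.
move=> ii; have := lb_neq0 i; have := lb_neq0 i'.
have : lb i != lb i' by rewrite (can_eq lbK).
move: x y z => [[l j] a] [[m j'] a'] [[k j''] a''].
move: (lb i) (lb i') => c c' cc c0 c'0 /and4P[/and4P[_ _ _ +]].
rewrite /arm /= => + h1 h2 h3 /and4P[_ h4 h5 h6].
have [e e' e''] : [/\ (l, j) = (lab0, 0), (m, j') = (lab0, 0) & (k, j'') = (lab0, 0)].
  move: h1 h2 h3 h4 h5 h6 cc c0 c'0.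
  by move: l m k c c' => [[] []] [[] []] [[] []] [[] []] [[] []] //= /andP[_ /eqP->] /andP[_ /eqP->] /andP[_ /eqP->].
by rewrite e e' e'' !eqxx.
Qed.

Lemma card_label_pred (Q : pred (label * I)) :
  #|[pred l | Q l]| = (\sum_j Q (true, true, j) + \sum_j Q (true, false, j) +
    (\sum_j Q (false, true, j) + \sum_j Q (false, false, j)))%N.
Proof.
rewrite -sum1_card big_mkcond /=.
rewrite (eq_bigr (fun x => Q (x.1, x.2) : nat)); last first.
  by move=> [l j] _; rewrite !inE; case: (Q _).
rewrite -(pair_bigA _ (fun l j => Q (l, j) : nat)) /=.
rewrite (eq_bigr (fun l => \sum_j (Q (l.1, l.2, j) : nat))%N); last by case.
by rewrite -(pair_bigA _ (fun a b => \sum_j (Q (a, b, j) : nat))%N) /= !big_bool.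
Qed.

Lemma card_stem : (\sum_(j < n.+1) (r && (j == ord0)) = r)%N.
Proof.
rewrite (bigD1 ord0) //= eqxx andbT big1 ?addn0 // => j /negbTE ->.
by rewrite andbF.
Qed.

Lemma sum_ones : (\sum_(j < n.+1) 1 = n.+1)%N.
Proof. by rewrite sum_nat_const card_ord muln1. Qed.

Lemma card_arm i : #|[pred l | arm (lb i) l]| = (n.+1 + r)%N.
Proof.
rewrite card_label_pred /arm /=; case: (lb i) (lb_neq0 i) => [[] []] //= _.
all: by rewrite card_stem !sum_ones ?sum_nat_const ?muln0 ?addn0 ?add0n.
Qed.

Lemma card_valid : #|[pred l | valid l]| = (3 * n.+1 + r)%N.
Proof. rewrite card_label_pred /valid /= card_stem !sum_ones; lia. Qed.

Lemma design_triple_card :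
  design false 'I_(n.+1 + r) -> design false 'I_(3 * n.+1 + r).
Proof.
move=> D; have Da i : decomposable (@shift (label * I)) (tri_on false (arm (lb i))).
  apply/design_sub; apply: design_bij D.
  by rewrite card_ord -(card_arm i) card_sig.
suff H : decomposable (@shift (label * I)) (tri_on false valid).
  move/design_sub: H; apply: design_bij.
  by rewrite card_ord -card_valid card_sig.
apply: (decomposable_eq (fun x y z => esym (triple_parts x y z))).
apply: (decomposable_eq (T := fun x y z => ((((stem_part x y z || mixed_part x y z) ||
  pair_part x y z) || tri_on false (arm (lb 0)) x y z) || tri_on false (arm (lb 1)) x y z) ||
  tri_on false (arm (lb (-1))) x y z)).
  by move=> x y z; rewrite -!orbA.
apply: decomposable_union2; last first.
- move=> x y z /orP[/orP[|]|]; last by apply: arm_disjoint.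
    by rewrite -orbA; apply: cross_arm_disjoint.
  by apply: arm_disjoint.
- exact: Da.
apply: decomposable_union2; last first.
- move=> x y z /orP[|]; last by apply: arm_disjoint.
  by rewrite -orbA; apply: cross_arm_disjoint.
- exact: Da.
apply: decomposable_union2; last first.
- by move=> x y z; rewrite -orbA; apply: cross_arm_disjoint.
- exact: Da.
apply: decomposable_union2 pair_part_decomposable cross_pair_disjoint.
exact: decomposable_union2 stem_part_decomposable mixed_part_decomposable stem_mixed_disjoint.
Qed.
End Tripling.

(** * Doubling, and small designs *)

Lemma design_one : design false 'I_1.
Proof.
by exists (fun x _ _ => x) => -[i a] [j b] [k c]; rewrite /tri /= !ord1 eqxx !andbF.
Qed.

(** Zero-sum transversals over integers modulo 2 and modulo 3. Negating the column on two of the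
    four labels makes the shift preserve the sum. *)
Lemma design_label : design true label.
Proof.
pose G := ('I_2 * 'I_3)%type.
pose F (l : label) (y : Y) : G := (if y.1 then 1 else 0, if l.1 then - y.2 else y.2).
pose F' (l : label) (g : G) : Y := (g.1 != 0, if l.1 then - g.2 else g.2).
pose e (l : label) : G := (0, if l.1 then -1 else 1).
have D : decomposable (fun x : label * Y => (x.1, (x.2.1, x.2.2 + 1)))
    (transversal4 F F' (fun _ _ => true)).
  apply: (@transversal4_decomposable Y (fun y => (y.1, y.2 + 1)) G F F' e) => //.
  - by move=> l [p a]; rewrite /F /F' /=; case: p; case: l.1; rewrite ?opprK.
  - move=> l [p a]; rewrite /F /F' /=; congr (_, _); last by case: l.1; rewrite ?opprK.
    by case: p => [[|[|]]] //= h; apply: val_inj.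
  - move=> l [p a]; rewrite /F /e /= -[RHS]/(_ + 0, _ + _) addr0.
    by case: l.1; rewrite /= ?opprD.
  - by move=> [[] []] [[] []] [[] []] //= _ _ _; congr (_, _); apply: val_inj.
by apply: decomposable_eq D => x y z; rewrite /transversal4 /tri !andbT.
Qed.

Section Doubling.
Variable n : nat.
Notation I := 'I_n.+1.
Notation M := ((bool * I) * Y)%type.

(** Every edge inside a half is coloured, so the blocks of two equally coloured edges cover all
    triples meeting both halves; the given design fills each half. *)
Lemma design_double : design false I -> design false 'I_(n.+1.*2).
Proof.
move=> D.
pose split (x : M) : bool * (bool * (I * 'I_3)) := (x.1.1, (x.2.1, (x.1.2, x.2.2))).
pose merge (x : bool * (bool * (I * 'I_3))) : M := ((x.1, x.2.2.1), (x.2.1, x.2.2.2)).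
pose TQ (x y z : M) := pair_tri (@predT bool) (allowed_edge predT) (split x) (split y) (split z).
have DQ : decomposable (@shift (bool * I)) TQ.
  have gf x : split (merge x) = x by case: x => [l [p [j a]]].
  have fg x : merge (split x) = x by case: x => [[l j] [p a]].
  apply: (decomposable_transport (f := merge) (g := split) _ _ _
    (colouring_decomposable predT (0, 1) predT)).
  - by move=> x y z; rewrite /TQ !gf.
  - by move=> x y z; rewrite !fg.
  - by move=> [l [p [j a]]]; rewrite -[(l, (p, (j, a))).2.2 + _]/(j + 0, a + 1) addr0.
pose arm (c : bool) := [pred l : bool * I | l.1 == c].
have Da c : decomposable (@shift (bool * I)) (tri_on false (arm c)).
  apply/design_sub; apply: design_bij D; rewrite card_sig.
  have -> : #|[pred l : bool * I | arm c l]| = #|image (fun j : I => (c, j)) predT|.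
    apply: eq_card => -[b j]; rewrite !inE /=; apply/eqP/imageP => [->|[i _ [-> _]] //].
    by exists j.
  by rewrite card_image // => i j [].
have DU := decomposable_union2 DQ (decomposable_union2 (Da true) (Da false) _) _.
have neE (l : bool) (i i' : I) (a a' : Y) :
    ((l, i, a) != (l, i', a')) = allowed_edge predT (a.1, (i, a.2)) (a'.1, (i', a'.2)).
  rewrite /allowed_edge orbT andbT; congr (~~ _).
  by case: a a' => [p a] [p' a']; rewrite !xpair_eqE eqxx /= andbCA.
have cardE : #|{: bool * I}| = #|'I_(n.+1.*2)|.
  by rewrite card_prod card_bool !card_ord mul2n.
apply: (design_bij cardE).
apply: decomposable_eq (DU _ _); last first.
- move=> [[l j] a] [[m j'] a'] [[k j''] a''].
  by rewrite /TQ /pair_tri /tri_on /arm /=; case: l m k => [] [] []; rewrite /= ?andbF.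
- move=> [[l j] a] [[m j'] a'] [[k j''] a''].
  by rewrite /tri_on /arm /=; case: l m k => [] [] []; rewrite /= ?andbF.
move=> [[l j] a] [[m j'] a'] [[k j''] a''].
rewrite /TQ /pair_tri /tri_on /tri /arm /=; case: l m k => [] [] [];
  by rewrite /= ?andbF ?andbT ?orbF ?orbT //= ?neE.
Qed.
End Doubling.

(** A translation-invariant system is determined by its blocks [0, a, b, f a b] through zero. The
    second condition on [f] compares such a block with its translate by [- a]. *)
Lemma cyclic_decomposable (Z : zmodType) (h : Z) (R : rel Z) (f : Z -> Z -> Z) :
  (forall a b, R a b -> [/\ R b a /\ f b a = f a b,
     R (- a) (b - a) /\ a + f (- a) (b - a) = f a b,
     R a (f a b) /\ f a (f a b) = b & a != 0 /\ f a b != b]) ->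
  decomposable (fun x => x + h) (fun x y z => R (y - x) (z - x)).
Proof.
move=> H; exists (fun x y z => x + f (y - x) (z - x)) => x y z Rxyz.
have [[R1 e1] [R2 e2] [R3 e3] [n1 n2]] := H _ _ Rxyz.
have hh a : a + h - (x + h) = a - x by rewrite opprD addrACA subrr addr0.
have xk a : x + a - x = a by rewrite addrC addKr.
have exy : - (y - x) = x - y by rewrite opprB.
have ezy : z - x - (y - x) = z - y by rewrite opprB addrA subrK.
rewrite ezy exy in R2 e2.
split; split=> //; rewrite ?hh ?xk ?e1 ?e3 //.
- by rewrite -e2 addrA (addrC x (y - x)) subrK.
- by rewrite addrC subrK.
- by rewrite addrAC.
- by rewrite eq_sym -subr_eq0.
- by apply: contraNneq n2 => e; rewrite -{2}e xk.
Qed.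

Section Cyclic.
Variables (kind : bool) (n : nat) (mults : seq nat) (base : seq (seq nat)).
Local Open Scope nat_scope.
Let N := (n * 6 + 5).+1.

(* The blocks through [0] of the cyclic system on [Z_N] generated by [base] and [mults]. *)
Definition star : seq (seq nat) := undup
  [seq [seq (x + (N - t)) * p.2 %% N | x <- p.1] |
    p <- [seq (b, u) | b <- base, u <- mults], t <- p.1].

(** The default 0 never passes [star_check], because [diff_tri a 0] is false. *)
Definition fourth_in (S : seq (seq nat)) (a b : nat) : nat :=
  let t := head [::] [seq t <- S | (a \in t) && (b \in t)] in
  head 0 [seq w <- t | [&& w != 0, w != a & w != b]].

Definition diff_tri (a b : nat) : bool :=
  if kind then [&& a %% n.+1 != 0, b %% n.+1 != 0 & a %% n.+1 != b %% n.+1]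
  else [&& a != 0, b != 0, a != b & ~~ ((a %% n.+1 == 0) && (b %% n.+1 == 0))].

(** The hypotheses of [cyclic_decomposable], stated on natural numbers so that they can be
    evaluated. *)
Definition star_check (S : seq (seq nat)) : bool :=
  all (fun a => all (fun b => diff_tri a b ==>
    let c := fourth_in S a b in let a' := (N - a) %% N in let b' := (b + a') %% N in
    [&& fourth_in S b a == c, diff_tri b a, (a + fourth_in S a' b') %% N == c, diff_tri a' b',
        diff_tri a c, fourth_in S a c == b, a != 0, c != b & c < N]) (iota 0 N)) (iota 0 N).

(** The residue of a point modulo [n + 1] is its group; its quotient, below 6, gives the row bit by
    parity and the column by halving. Translation by [2 (n + 1)] is then the column shift. *)
Lemma star_design : star_check star -> design kind 'I_n.+1.
Proof.
move=> chk.
pose Z := 'I_N.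
pose R (a b : Z) := diff_tri a b.
pose f (a b : Z) : Z := inZp (fourth_in star a b).
have H (a b : Z) : R a b -> [/\ R b a /\ f b a = f a b,
     R (- a)%R (b - a)%R /\ (a + f (- a) (b - a))%R = f a b,
     R a (f a b) /\ f a (f a b) = b & a != 0%R /\ f a b != b].
  move=> Rab; move/allP: chk => /(_ a); rewrite mem_iota ltn_ord => /(_ isT).
  move/allP => /(_ b); rewrite mem_iota ltn_ord => /(_ isT); rewrite -/(R a b) Rab /=.
  case/and5P=> /eqP e1 r1 /eqP e2 r2 /and5P[r3 /eqP e3 a0 cb cN].
  have vf : f a b = fourth_in star a b :> nat by rewrite /= modn_small.
  split; split=> //.
  - by rewrite /f e1.
  - by apply: ord_inj; rewrite /= modnDmr e2 modn_small.
  - by rewrite /R vf.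
  - by apply: ord_inj; rewrite -[LHS]/(fourth_in star a (f a b) %% N) vf e3 modn_small.
  - by apply: contraNneq cb => e; rewrite -vf e.
have D := cyclic_decomposable (inZp (n.+1).*2 : Z) H.
have nN : n.+1 %| N by rewrite /N -addn1; apply/dvdnP; exists 6; lia.
pose dec (x : Z) : 'I_n.+1 * Y := (inZp x, (odd (x %/ n.+1), inZp (x %/ n.+1)./2)).
pose enc (p : 'I_n.+1 * Y) : Z := inZp (p.1 + n.+1 * (p.2.1 + p.2.2.*2)).
have venc p : enc p = p.1 + n.+1 * (p.2.1 + p.2.2.*2) :> nat.
  rewrite /= modn_small //; case: p => [i [b c]] /=.
  have := ltn_ord i; have := ltn_ord c; move: (nat_of_ord i) (nat_of_ord c) => i' c'.
  by case: b; rewrite /N; case: c' => [|[|[|c']]] //; lia.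
have decK x : enc (dec x) = x.
  apply: ord_inj; rewrite venc /dec /=.
  rewrite (@modn_small _ 3); last first.
    by have := ltn_ord x; rewrite {2}/N => hx; rewrite -divn2 -divnMA ltn_divLR //; lia.
  by rewrite odd_double_half mulnC addnC -divn_eq.
have encK p : dec (enc p) = p.
  rewrite /dec venc; case: p => [i [b c]] /=.
  have -> : (i + n.+1 * (b + c.*2)) %/ n.+1 = b + c.*2.
    by rewrite addnC mulnC divnMDl // divn_small ?addn0.
  congr (_, (_, _)).
  - by apply: ord_inj; rewrite /= addnC mulnC modnMDl modn_small.
  - by rewrite oddD odd_double addbF oddb.
  - by apply: ord_inj; rewrite /= half_bit_double modn_small.
have dec_shift x : dec (x + inZp (n.+1).*2)%R = shift (dec x).
  rewrite -{1}(decK x); move: (dec x) => {x} p; rewrite -[RHS]encK; congr dec.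
  apply: ord_inj; rewrite [RHS]venc /= modnDmr modnDml; case: p => [i [b c]] /=.
  have := ltn_ord i; have := ltn_ord c; move: (nat_of_ord i) (nat_of_ord c) => i' c'.
  have m0 : (0 + 1 %% 3) %% 3 = 1 by []. have m1 : (1 + 1 %% 3) %% 3 = 2 by [].
  have m2 : (2 + 1 %% 3) %% 3 = 0 by [].
  case: c' => [|[|[|c']]] // _ hi; rewrite ?m0 ?m1 ?m2 /N.
  - by rewrite modn_small; case: b; lia.
  - by rewrite modn_small; case: b; lia.
  - have -> : i' + n.+1 * (b + 2.*2) + n.+1.*2 = N + (i' + n.+1 * b) by rewrite /N; lia.
    by rewrite modnDl modn_small /N /=; case: b; lia.
have modD (a b : Z) : ((a + b)%R : nat) = a + b %[mod n.+1] by rewrite /= modn_dvdm.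
have dmod (x y : Z) : ((y - x)%R %% n.+1 == 0) = (x %% n.+1 == y %% n.+1).
  have -> : (x == y %[mod n.+1]) = (0 + x == (y - x)%R + x %[mod n.+1]).
    by rewrite -modD subrK.
  by rewrite eqn_modDr mod0n eq_sym.
have ddmod (x y z : Z) : ((y - x)%R == (z - x)%R %[mod n.+1]) = (y == z %[mod n.+1]).
  by rewrite -(eqn_modDr x) -!modD !subrK.
have dec1 x y : ((dec x).1 == (dec y).1) = (x %% n.+1 == y %% n.+1) by rewrite -val_eqE.
have dec0 x y : (dec x == dec y) = (x == y) by rewrite (can_eq decK).
have triE x y z : tri kind (dec x) (dec y) (dec z) = R (y - x)%R (z - x)%R.
  rewrite /tri /R /diff_tri; case: kind; first by rewrite !dec1 !dmod ddmod.
  rewrite !dec1 !dec0 !dmod; congr [&& ~~ _, ~~ _, ~~ _ & _].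
  - by rewrite -[RHS]/((y - x)%R == 0%R) subr_eq0 eq_sym.
  - by rewrite -[RHS]/((z - x)%R == 0%R) subr_eq0 eq_sym.
  - by rewrite -[RHS]/((y - x)%R == (z - x)%R) (inj_eq (addIr _)).
apply: (decomposable_transport (f := dec) (g := enc) _ _ dec_shift D).
- by move=> x y z; rewrite triE !decK.
- by move=> x y z; rewrite -triE !encK.
Qed.
End Cyclic.

(* The base blocks of the next two designs were found by computer search. *)
Lemma design5 : design false 'I_5.
Proof.
(* The multipliers are the units modulo 30. *)
apply: (@star_design false 4 [:: 1; 7; 11; 13; 17; 19; 23; 29]%N
  [:: [:: 0; 1; 2; 16]; [:: 0; 3; 6; 18]; [:: 0; 3; 9; 12]; [:: 0; 1; 5; 19]; [:: 0; 1; 8; 9];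
      [:: 0; 1; 4; 20]; [:: 0; 2; 6; 26]; [:: 0; 1; 10; 21]; [:: 0; 1; 3; 28]; [:: 0; 1; 7; 18];
      [:: 0; 1; 6; 25]]%N).
by vm_compute.
Qed.

Lemma design6 : design true 'I_6.
Proof.
(* The multipliers are the units modulo 36 that are 1 modulo 4. *)
apply: (@star_design true 5 [:: 1; 5; 13; 17; 25; 29]%N
  [:: [:: 0; 1; 10; 20]; [:: 0; 1; 9; 17]; [:: 0; 1; 2; 28]; [:: 0; 1; 11; 26]; [:: 0; 1; 3; 4];
      [:: 0; 1; 5; 16]]%N).
by vm_compute.
Qed.

(** * Inflating a Steiner system with block sizes 4 and 6 *)

Definition steiner46 (V : finType) (cl : V -> V -> V -> {set V}) :=
  forall x y z, distinct3 x y z ->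
  [/\ [&& x \in cl x y z, y \in cl x y z & z \in cl x y z],
      (#|cl x y z| == 4)%N || (#|cl x y z| == 6)%N
    & forall a b c, distinct3 a b c -> a \in cl x y z -> b \in cl x y z -> c \in cl x y z ->
        cl a b c = cl x y z].

(** The groups, of size 6, serve as blocks for the triples that the quadruples leave uncovered. *)
Lemma design_steiner46 (J : finType) :
  design false J -> exists cl, @steiner46 (J * Y)%type cl.
Proof.
case=> q qP.
pose same (x y z : J * Y) := (x.1 == y.1) && (x.1 == z.1).
exists (fun x y z => if same x y z then [set p | p.1 == x.1] else block q x y z).
move=> x y z /and3P[xy xz yz].
have [/andP[/eqP xy1 /eqP xz1]|ns] := boolP (same x y z).
  rewrite !inE -xy1 -xz1 eqxx; split=> //.
    have -> : #|[set p : J * Y | p.1 == x.1]| = #|image (fun a : Y => (x.1, a)) predT|.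
      apply: eq_card => -[j a]; rewrite !inE /=; apply/eqP/imageP => [->|[b _ [-> _]] //].
      by exists a.
    by rewrite card_image ?card_prod ?card_bool ?card_ord // => a b [].
  move=> a b c _; rewrite !inE => /eqP ax /eqP bx /eqP cx.
  by rewrite /same ax bx cx eqxx.
have t : tri false x y z by rewrite /tri xy xz yz.
split; first by rewrite !inE !eqxx !orbT.
  by rewrite (card_block qP t).
move=> a b c d ha hb hc; have [t' <-] := quad_block qP t d ha hb hc.
by case/and4P: t' => _ _ _ /negbTE; rewrite /same => ->.
Qed.

Section Inflate.
Variables (V : finType) (oo : V) (cl : V -> V -> V -> {set V}).
Hypotheses (clP : steiner46 cl) (G3 : design false 'I_3) (G5 : design false 'I_5)
  (H4 : design true 'I_4) (H6 : design true 'I_6).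

Definition is_block (K : {set V}) :=
  [exists x, exists y, exists z, distinct3 x y z && (K == cl x y z)].

Definition piece (K : {set V}) (x y z : V * Y) :=
  is_block K && (if oo \in K then tri_on false [pred v in K :\ oo] x y z
                 else tri_on true [pred v in K] x y z).

Lemma is_blockP K : is_block K -> exists x y z, distinct3 x y z /\ K = cl x y z.
Proof.
by case/existsP=> x /existsP[y /existsP[z /andP[d /eqP e]]]; exists x, y, z.
Qed.

Lemma block_eq K a b c : is_block K -> distinct3 a b c -> a \in K -> b \in K -> c \in K ->
  K = cl a b c.
Proof.
move=> /is_blockP[x [y [z [d ->]]]] dabc aK bK cK.
by have [_ _ /(_ a b c) ->] := clP d.
Qed.

Lemma is_block_cl a b c : distinct3 a b c -> is_block (cl a b c).
Proof.
move=> d; apply/existsP; exists a; apply/existsP; exists b; apply/existsP; exists c.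
by rewrite d eqxx.
Qed.

Lemma design_on b (K : {set V}) m : #|K| = m -> design b 'I_m ->
  decomposable (@shift V) (tri_on b [pred v in K]).
Proof.
move=> cK D; apply/design_sub; apply: design_bij D.
by rewrite card_ord card_sig -cK; apply: eq_card.
Qed.

Lemma piece_decomposable K : decomposable (@shift V) (piece K).
Proof.
have [bK|nb] := boolP (is_block K); last first.
  by exists (fun x _ _ => x) => x y z; rewrite /piece (negbTE nb).
have cK : (#|K| == 4)%N || (#|K| == 6)%N.
  by have [x [y [z [d ->]]]] := is_blockP bK; have [] := clP d.
have [ooK|nooK] := boolP (oo \in K).
  apply: (decomposable_eq (T := tri_on false [pred v in K :\ oo])).
    by move=> x y z; rewrite /piece bK ooK.
  have := cardsD1 oo K; rewrite ooK.
  by case/orP: cK => /eqP -> [c]; [apply: design_on G3|apply: design_on G5].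
apply: (decomposable_eq (T := tri_on true [pred v in K])).
  by move=> x y z; rewrite /piece bK (negbTE nooK).
by case/orP: cK => /eqP c; [apply: design_on H4|apply: design_on H6].
Qed.

(** The pair [u], [v] serves to identify the block through [oo], [u], [v] when the triple meets only
    two groups. *)
Lemma tri_two (x y z : V * Y) : tri false x y z ->
  exists u v, [/\ u != v, u \in [:: x.1; y.1; z.1], v \in [:: x.1; y.1; z.1]
    & distinct3 x.1 y.1 z.1 \/ {subset [:: x.1; y.1; z.1] <= [:: u; v]}].
Proof.
rewrite /tri => /and4P[_ _ _]; rewrite /distinct3.
have [e1|n1] := eqVneq x.1 y.1; have [e2|n2] := eqVneq x.1 z.1 => //= _.
- exists x.1, z.1; rewrite !inE !eqxx ?orbT; split=> //; right=> t.
  by rewrite !inE -e1 orbA orbb.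
- exists x.1, y.1; rewrite !inE !eqxx ?orbT; split=> //; right=> t.
  by rewrite !inE -e2 orbA orbC orbA orbb.
- exists x.1, y.1; rewrite !inE !eqxx ?orbT; split=> //.
  have [e3|n3] := eqVneq y.1 z.1; last by left.
  by right=> t; rewrite !inE -e3 orbb.
Qed.

Lemma pieceP K x y z : reflect [/\ is_block K, tri false x y z,
    {subset [:: x.1; y.1; z.1] <= K :\ oo} & oo \in K \/ distinct3 x.1 y.1 z.1]
  (piece K x y z).
Proof.
rewrite /piece /tri_on; apply: (iffP andP) => [[bK]|[bK t sK ok]].
  case: ifP => [ooK /and4P[t kx ky kz]|nooK /and4P[t kx ky kz]]; split=> //; last by right.
  - by move=> v; rewrite !inE => /or3P[] /eqP ->; rewrite inE in kx ky kz; move: kx ky kz; rewrite !inE.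
  - by left.
  - case/and3P: t => t1 t2 t3; rewrite /tri (negbTE t1) andbT.
    by apply/and3P; split; [apply: contraNneq t1|apply: contraNneq t2|apply: contraNneq t3] => ->.
  - move=> v h; have vK : v \in K by move: h; rewrite !inE => /or3P[] /eqP ->.
    by rewrite in_setD1 vK andbT; apply: contraTneq vK => ->; rewrite nooK.
split=> //.
have [kx ky kz] : [/\ x.1 \in K :\ oo, y.1 \in K :\ oo & z.1 \in K :\ oo].
  by split; apply: sK; rewrite !inE eqxx ?orbT.
case: ifP => ooK; first by rewrite t /= kx ky kz.
case: ok => [|d]; first by rewrite ooK.
rewrite /tri -/(distinct3 _ _ _) d.
by move: kx ky kz; rewrite !inE => /andP[_ ->] /andP[_ ->] /andP[_ ->].
Qed.

(** A triple meeting three groups belongs to the piece of the block through these three points of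
    [V]; one meeting only the groups [u] and [v] belongs to the piece of the block through [oo],
    [u], [v]. *)
Lemma design_inflate : design false {v | v != oo}.
Proof.
apply/design_sub.
apply: (decomposable_eq (T := fun x y z => [exists K, piece K x y z])); last first.
  apply: decomposable_union piece_decomposable _ => K K' x y z.
  case/pieceP=> bK t sK dK /pieceP[bK' _ sK' dK'].
  have sub (L : {set V}) : {subset [:: x.1; y.1; z.1] <= L :\ oo} ->
      forall v, v \in [:: x.1; y.1; z.1] -> v \in L /\ v != oo.
    by move=> sL v /sL; rewrite !inE => /andP[].
  have [u [v [uv ux vx _]]] := tri_two t.
  have [[uK uo] [vK vo]] := (sub _ sK _ ux, sub _ sK _ vx).
  have [[uK' _] [vK' _]] := (sub _ sK' _ ux, sub _ sK' _ vx).
  have d3 : distinct3 x.1 y.1 z.1 -> K = K'.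
    have mem w : w \in [:: x.1; y.1; z.1] -> w \in K /\ w \in K'.
      by move=> hw; have [? _] := sub _ sK _ hw; have [? _] := sub _ sK' _ hw.
    have [? ?] := mem x.1 (mem_head _ _).
    have [|? ?] := mem y.1; first by rewrite !inE eqxx orbT.
    have [|? ?] := mem z.1; first by rewrite !inE eqxx !orbT.
    by move=> d; rewrite (block_eq bK d) // (block_eq bK' d).
  (* If three distinct groups do not decide, both blocks contain [oo], [u] and [v]. *)
  case: dK => [oK|/d3 //]; case: dK' => [oK'|/d3 //].
  have d : distinct3 oo u v by rewrite /distinct3 uv !(eq_sym oo) uo vo.
  by rewrite (block_eq bK d) // (block_eq bK' d).
move=> x y z; apply/existsP/and4P.
  case=> K /pieceP[bK t sK _].
  by split=> //; apply/eqP => e; have := sK oo; rewrite !inE -e !eqxx ?orbT => /(_ isT).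
case=> t xo yo zo.
have so w : w \in [:: x.1; y.1; z.1] -> w != oo.
  by rewrite !inE => /or3P[] /eqP ->.
have [u [v [uv ux vx cs]]] := tri_two t.
have [d3|nd3] := boolP (distinct3 x.1 y.1 z.1).
  exists (cl x.1 y.1 z.1); apply/pieceP; split=> //; first exact: is_block_cl.
    have [/and3P[? ? ?] _ _] := clP d3.
    by move=> w hw; rewrite in_setD1 (so _ hw); move: hw; rewrite !inE => /or3P[] /eqP ->.
  by right.
case: cs => [|cs]; first by rewrite (negbTE nd3).
have d : distinct3 oo u v by rewrite /distinct3 uv !(eq_sym oo) !so.
have [/and3P[o1 o2 o3] _ _] := clP d.
exists (cl oo u v); apply/pieceP; split=> //; [exact: is_block_cl| |by left].
by move=> w hw; rewrite in_setD1 (so _ hw); have := cs _ hw; rewrite !inE => /orP[] /eqP ->.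
Qed.
End Inflate.

(** * Existence of the group designs *)

Lemma design_exists m : (0 < m)%N -> design false 'I_m.
Proof.
have H4 : design true 'I_4.
  by apply: design_bij design_label; rewrite card_prod card_bool card_ord.
have G3 : design false 'I_3 by apply: (@design_triple_card 0 false); exact: design_one.
elim/ltn_ind: m => m IH m0.
have [k [r [mk r3]]] : exists k r, (m = 3 * k + r /\ r < 3)%N.
  by exists (m %/ 3)%N, (m %% 3)%N; rewrite ltn_mod mulnC -divn_eq.
case: r r3 mk => [|[|[|r]]] // _ mk.
- case: k mk => [|k] mk; first by rewrite mk in m0.
  by rewrite mk; apply: (@design_triple_card k false); apply: IH; lia.
- case: k mk => [|k] mk; first by rewrite mk; exact: design_one.
  by rewrite mk; apply: (@design_triple_card k true); apply: IH; lia.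
have [od|ev] := boolP (odd m); last first.
  have [h mh] : exists h, m = h.+1.*2 by exists m./2.-1; lia.
  by rewrite mh; apply: design_double; apply: IH; lia.
have [j mj] : exists j, m = (6 * j + 5)%N by exists (m %/ 6)%N; lia.
case: j mj => [|j] mj; first by rewrite mj; exact: design5.
(* There are [6 (j + 2) = m + 1] points; removing one leaves [m], the groups of the new design. *)
have [cl clP] : exists cl, @steiner46 ('I_j.+2 * Y)%type cl.
  by apply: design_steiner46; apply: IH; lia.
have D := design_inflate (ord0, (false, 0)) clP G3 design5 H4 design6.
apply: design_bij D; rewrite card_sig cardC1 card_ord !card_prod card_bool !card_ord; lia.
Qed.

Section Extra.
Variable J : eqType.

(** The triples left out include every shift orbit [x, s x, s (s x)], so that no block is invariant
    under the shift. *)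
Definition full (x y z : J * Y) :=
  [&& distinct3 x y z &
      ~~ [&& x.1 == y.1, x.1 == z.1 & distinct3 x.2.2 y.2.2 z.2.2]].

Definition extra (x y z : J * Y) :=
  [&& distinct3 x y z, x.1 == y.1, x.1 == z.1 & ~~ distinct3 x.2.2 y.2.2 z.2.2].

(* The blocks of [extra] are the complements of the columns inside a group. *)
Lemma extra_decomposable : decomposable (@shift J) extra.
Proof.
(* Two points share a column and the fourth joins the odd one out; the four row bits sum to zero. *)
exists (fun x y z => (x.1, (x.2.1 (+) y.2.1 (+) z.2.1,
  if x.2.2 == y.2.2 then z.2.2 else if x.2.2 == z.2.2 then y.2.2 else x.2.2))).
move=> [i [p a]] [j [p' a']] [k [p'' a'']]; rewrite /extra /distinct3 /shift /=.
case/and4P=> h /eqP ij /eqP ik; move: h; rewrite -{j}ij -{k}ik !xpair_eqE eqxx /=.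
rewrite !(inj_eq (addIr 1)).
have [e1|/negbTE n1] := eqVneq a a'.
  have [e2|/negbTE n2] := eqVneq a a''; subst; first by rewrite ?eqxx; case: p p' p'' => [] [] [].
  have n2' : (a'' == a') = false by rewrite eq_sym.
  rewrite ?eqxx ?n2 ?n2'.
  by case: p p' p'' => [] [] [] //= _ _; do !split.
have [e2|/negbTE n2] := eqVneq a a''.
  subst a''; have n1' : (a' == a) = false by rewrite eq_sym.
  rewrite ?eqxx ?n1 ?n1'.
  by case: p p' p'' => [] [] [] //= _ _; do !split.
have [e3|/negbTE n3] := eqVneq a' a''; last by rewrite /= ?andbF.
subst a''; have n1' : (a' == a) = false by rewrite eq_sym.
rewrite ?eqxx ?n1 ?n1'.
by case: p p' p'' => [] [] [] //= _ _; do !split.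
Qed.
End Extra.

(** * From designs to orthogonal codes *)

Lemma card_distinct3 (V : finType) (A : {set V}) :
  #|[set t : V * V * V | [&& t.1.1 \in A, t.1.2 \in A, t.2 \in A & distinct3 t.1.1 t.1.2 t.2]]|
  = (#|A| * (#|A|.-1 * #|A|.-2))%N.
Proof.
transitivity (\sum_(x in A) \sum_(y in A :\ x) \sum_(z in A :\ x :\ y) 1)%N; last first.
  rewrite -sum_nat_const; apply: eq_bigr => x xA.
  have cx : #|A :\ x| = #|A|.-1 by rewrite (cardsD1 x A) xA.
  rewrite -cx -sum_nat_const; apply: eq_bigr => y yA.
  by rewrite sum1_card (cardsD1 y (A :\ x)) yA.
rewrite pair_big_dep pair_big_dep /= sum1_card; apply: eq_card => -[[x y] z].
rewrite inE -[RHS]/((x \in A) && (y \in A :\ x) && (z \in A :\ x :\ y)) !in_setD1.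
rewrite /distinct3 /= (eq_sym y x) !(eq_sym z).
by do 3!case: (_ \in A); do 3!case: (_ == _).
Qed.

Section Orbits.
Variables (P : finType) (s : P -> P) (T : P -> P -> P -> bool) (q : P -> P -> P -> P).
Hypothesis qP : quad_map s T q.
Hypothesis s3 : forall x, s (s (s x)) = x.
Hypothesis Ts : forall x, T x (s x) (s (s x)) = false.
Hypothesis s1 : forall x, s x != x.

Let sI : injective s.
Proof. by move=> x y e; rewrite -(s3 x) e s3. Qed.

Definition sset (b : {set P}) := s @: b.
Definition orb b := [set b; sset b; sset (sset b)].
Definition blocks := [set block q t.1.1 t.1.2 t.2 | t in [pred t : P * P * P | T t.1.1 t.1.2 t.2]].

Lemma sset3 b : sset (sset (sset b)) = b.
Proof.
by rewrite /sset -!imset_comp; rewrite (eq_imset (g := id)) ?imset_id // => x /=; rewrite s3.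
Qed.

Lemma orb_sset b : orb (sset b) = orb b.
Proof. by apply/setP => c; rewrite !inE sset3 orbC orbA. Qed.

Lemma orb_eq b c : c \in orb b -> orb c = orb b.
Proof. by rewrite !inE -orbA => /or3P[] /eqP ->; rewrite ?orb_sset. Qed.

(** The choice depends only on the set [orb b], hence is constant on an orbit. *)
Definition rep b := odflt b [pick c | c \in orb b].

Lemma rep_orb b : rep b \in orb b.
Proof. by rewrite /rep; case: pickP => [c //|/(_ b)]; rewrite !inE eqxx. Qed.

Lemma rep_eq b c : c \in orb b -> rep c = rep b.
Proof.
move=> cb; rewrite /rep (orb_eq cb); case: pickP => // /(_ b).
by rewrite !inE eqxx.
Qed.

Lemma blockP b : reflect (exists x y z, T x y z /\ b = block q x y z) (b \in blocks).
Proof.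
apply: (iffP imsetP) => [[[[x y] z] t ->]|[x [y [z [t ->]]]]]; first by exists x, y, z.
by exists (x, y, z).
Qed.

Lemma blocks_sset b : b \in blocks -> sset b \in blocks.
Proof.
case/blockP=> x [y [z [t ->]]]; apply/blockP; exists (s x), (s y), (s z).
have [_ _ _ [t' e] _] := qP t; split=> //.
by rewrite /block e /sset !imsetU !imset_set1.
Qed.

Lemma blocks_closed b x y z : b \in blocks -> distinct3 x y z ->
  x \in b -> y \in b -> z \in b -> T x y z /\ b = block q x y z.
Proof.
by case/blockP=> x' [y' [z' [t ->]]] d hx hy hz; have [? ->] := quad_block qP t d hx hy hz.
Qed.

Lemma blocks_eq b c x y z : b \in blocks -> c \in blocks -> distinct3 x y z ->
  x \in b -> y \in b -> z \in b -> x \in c -> y \in c -> z \in c -> b = c.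
Proof.
move=> bB cB d xb yb zb xc yc zc.
by have [_ ->] := blocks_closed bB d xb yb zb; have [_ ->] := blocks_closed cB d xc yc zc.
Qed.

(** An invariant block would contain some [x], [s x] and [s (s x)], which form no triple of [T]. *)
Lemma sset_neq b : b \in blocks -> sset b != b.
Proof.
move=> bB; apply/eqP => e.
have [x xb] : exists x, x \in b.
  by case/blockP: bB => x [y [z [_ ->]]]; exists x; rewrite !inE eqxx.
have sb y : y \in b -> s y \in b by move=> yb; rewrite -e; apply: imset_f.
have d : distinct3 x (s x) (s (s x)).
  have n1 : x != s x by rewrite eq_sym.
  rewrite /distinct3 (inj_eq sI) n1 andbT /=.
  by apply: contra_neq (s1 (s (s x))) => E; rewrite s3 -E.
have [] := blocks_closed bB d xb (sb _ xb) (sb _ (sb _ xb)).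
by rewrite Ts.
Qed.

Definition reps := rep @: blocks.

Lemma reps_block c : c \in reps -> c \in blocks.
Proof.
case/imsetP=> b bB ->; have := rep_orb b; rewrite !inE -orbA.
by case/or3P=> /eqP ->; do ?apply: blocks_sset.
Qed.

Lemma reps_fixed c : c \in reps -> rep c = c.
Proof. by case/imsetP=> b bB ->; rewrite (rep_eq (rep_orb b)). Qed.

Lemma iter_sset r b : iter r sset b = iter (r %% 3) sset b.
Proof.
rewrite {1}(divn_eq r 3) addnC iterD mulnC; congr (iter _ _ _).
by elim: (r %/ 3)%N => [|m IH]; rewrite ?muln0 // mulnS iterD IH /= sset3.
Qed.

Lemma mem_iter_sset r b x : (iter r s x \in iter r sset b) = (x \in b).
Proof. by elim: r => //= r <-; rewrite mem_imset. Qed.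

(** Three common points force [c] to be the shift of [b] by [r]. Then both represent the same orbit,
    so [b = c], and [sset_neq] gives that 3 divides [r]. *)
Lemma reps_corr b c r : b \in reps -> c \in reps -> (b != c) || (r %% 3 != 0)%N ->
  (#|[set x in b | iter r s x \in c]| <= 2)%N.
Proof.
move=> bR cR; apply: contraLR; rewrite -ltnNge => /card_gt2P[x [y [z [[]]]]].
rewrite !inE => /andP[xb xc] /andP[yb yc] /andP[zb zc] [xy yz zx].
have itB : iter r sset b \in blocks.
  by elim: r {xc yc zc} => [|r IH] /=; [apply: reps_block|apply: blocks_sset].
have itI : injective (iter r s) by elim: r {xc yc zc itB} => //= r IH u v /sI /IH.
have d : distinct3 (iter r s x) (iter r s y) (iter r s z).
  by rewrite /distinct3 !(inj_eq itI) xy yz (eq_sym x) zx.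
have cE : c = iter r sset b.
  by apply: (blocks_eq (reps_block cR) itB d) => //; rewrite mem_iter_sset.
have bc : b = c.
  rewrite -(reps_fixed bR) -(reps_fixed cR); symmetry; apply: rep_eq.
  by rewrite cE iter_sset; case: (r %% 3)%N (ltn_pmod r (isT : 0 < 3)%N) => [|[|[|]]] //=;
    rewrite !inE eqxx ?orbT.
rewrite negb_or bc eqxx /= negbK; move: cE; rewrite -bc iter_sset.
case: (r %% 3)%N (ltn_pmod r (isT : 0 < 3)%N) => [|[|[|]]] //= _ e.
  by have := sset_neq (reps_block bR); rewrite -e eqxx.
by have := sset_neq (reps_block bR); rewrite {1}e sset3 eqxx.
Qed.

(** An orbit has at most three blocks, each with 24 ordered triples. *)
Lemma card_reps :
  (#|[set t : P * P * P | T t.1.1 t.1.2 t.2]| <= 72 * #|reps|)%N.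
Proof.
set A := [set t | _].
pose f (t : P * P * P) := rep (block q t.1.1 t.1.2 t.2).
have fA t : t \in A -> f t \in reps.
  by rewrite inE => Tt; apply: imset_f; apply/blockP; exists t.1.1, t.1.2, t.2.
rewrite -sum1_card (partition_big f (mem reps)) //= mulnC -sum_nat_const.
apply: leq_sum => c cR.
pose D (b : {set P}) :=
  [set t : P * P * P | [&& t.1.1 \in b, t.1.2 \in b, t.2 \in b & distinct3 t.1.1 t.1.2 t.2]].
have cD b : b \in blocks -> #|D b| = 24.
  by case/blockP=> x [y [z [t ->]]]; rewrite card_distinct3 (card_block qP t).
have cB := reps_block cR.
rewrite sum1_card.
apply: (@leq_trans #|D c :|: D (sset c) :|: D (sset (sset c))|).
  apply/subset_leq_card/subsetP => -[[x y] z]; rewrite !inE /= => /andP[tA /eqP e].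
  have t : T x y z by rewrite inE in tA.
  have [d _ _ _] := quad_neq qP t.
  have : block q x y z \in orb c.
    by rewrite -e (orb_eq (rep_orb _)) !inE eqxx.
  by rewrite !inE d !andbT -!orbA => /or3P[] /eqP <-; rewrite !inE !eqxx ?orbT.
rewrite (leq_trans (leq_card_setU _ _)) // (cD (sset _)) ?blocks_sset //.
by rewrite (leq_trans (leq_add (leq_card_setU _ _) (leqnn _))) // !cD ?blocks_sset.
Qed.
End Orbits.

(** * Counting covered triples and orbits *)

Lemma full_decomposable (J : eqType) : design false J -> decomposable (@shift J) (@full J).
Proof.
move=> D; apply: decomposable_eq (decomposable_union2 D (@extra_decomposable J) _) => x y z.
  rewrite /tri /extra /full -/(distinct3 x y z); set d := distinct3 x.2.2 _ _.
  rewrite /distinct3; case: (x != y); case: (x != z); case: (y != z) => //=.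
  by case: (x.1 == y.1); case: (x.1 == z.1).
by rewrite /tri /extra => /and4P[_ _ _ /negbTE h] /and4P[_ h1 h2 _]; rewrite h1 h2 in h.
Qed.

Lemma distinct3_Z3 (a b c b' c' : 'I_3) : distinct3 a b c -> distinct3 a b' c' ->
  (b == a + 1) = (b' == a + 1) -> b = b' /\ c = c'.
Proof.
case: a b b' c c' => [[|[|[|//]]] ha] [[|[|[|//]]] hb] [[|[|[|//]]] hb'] [[|[|[|//]]] hc]
  [[|[|[|//]]] hc'] //= _ _ _.
all: by split; apply: val_inj.
Qed.

(** An omitted triple is determined by its first point, the two other row bits and the cyclic order
    of the columns: at most [6 m * 8] choices. *)
Lemma card_full m :
  (6 * m * ((6 * m).-1 * (6 * m).-2) - 48 * m <=
   #|[set t : ('I_m * Y) * ('I_m * Y) * ('I_m * Y) | full t.1.1 t.1.2 t.2]|)%N.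
Proof.
set W := ('I_m * Y)%type; set A := [set t | _].
have cW : #|[set: W]| = (6 * m)%N by rewrite cardsT !card_prod card_bool !card_ord mulnC.
have := @card_distinct3 W [set: W]; rewrite cW.
set E := [set t | _] => cE.
pose bad := [set t : W * W * W | [&& t.1.1.1 == t.1.2.1, t.1.1.1 == t.2.1 &
  distinct3 t.1.1.2.2 t.1.2.2.2 t.2.2.2]].
have cb : (#|bad| <= 48 * m)%N.
  pose f (t : W * W * W) : W * ((bool * bool) * bool) :=
    (t.1.1, ((t.1.2.2.1, t.1.2.2.2 == t.1.1.2.2 + 1), t.2.2.1)).
  have fI : {in bad &, injective f}.
    move=> [[[i [p a]] [j [p' a']]] [k [p'' a'']]] [[[i2 [q b]] [j2 [q' b']]] [k2 [q'' b'']]].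
    rewrite !inE /f /= => /and3P[/eqP <- /eqP <- d] /and3P[/eqP <- /eqP <- d'].
    case=> <- <- e <- e' <-; rewrite -e in d' e'.
    have [<- <-] : a' = b' /\ a'' = b''; last by rewrite e.
    exact: distinct3_Z3 d d' e'.
  rewrite -(card_in_imset fI) (leq_trans (max_card _)) // !card_prod card_bool !card_ord; lia.
rewrite leq_subLR addnC -cE (leq_trans _ (leq_add (leqnn #|A|) cb)) //.
apply: leq_trans (leq_card_setU A bad); apply/subset_leq_card/subsetP => -[[x y] z].
by rewrite !inE /= /full => d; rewrite d /= orNb.
Qed.

Lemma Jstar_bound m : (0 < m)%N ->
  (72 * Jstar m.*2 3 <= 6 * m * ((6 * m).-1 * (6 * m).-2) - 48 * m)%N.
Proof.
case: m => // m _.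
(* Here 6 divides [uv], and [v = 3] excludes both exceptional classes. *)
have -> : Jstar m.+1.*2 3 = ((m.+1.*2 * (Nbound m.+1.*2 3 - 1)) %/ 4)%N.
  have m6 : (m.+1.*2 * 3 %% 6)%N = 0%N by lia.
  by rewrite /Jstar /inA /inB m6 -[(3 %% 6)%N]/3%N !andbF.
rewrite /Nbound.
set N := (_ %/ 3)%N.
have N_le : (3 * N <= (6 * m + 5) * (3 * m + 2))%N.
  rewrite /N mulnC (leq_trans (leq_divM _ _)) //.
  have -> : ((m.+1.*2 * 3 - 2) %/ 2 = 3 * m + 2)%N by lia.
  by apply: leq_mul => //; lia.
(* The product is [18 m^2 + 27 m + 10], so [N] is at most [6 m^2 + 9 m + 3]. *)
have {}N_le : (N - 1 <= 6 * (m * m) + 9 * m + 2)%N by lia.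
have := leq_divM (m.+1.*2 * (N - 1)) 4; set J := (_ %/ 4)%N => J_le.
have {}J_le : (J * 4 <= m.+1.*2 * (6 * (m * m) + 9 * m + 2))%N.
  by apply: leq_trans J_le _; apply: leq_mul.
have -> : ((6 * m.+1).-1 = 6 * m + 5)%N by lia.
have -> : ((6 * m + 5).-1 = 6 * m + 4)%N by lia.
(* The term [48 (m + 1)] matches the omitted triples, and the factor 18 is [72 / 4]. *)
have -> : (6 * m.+1 * ((6 * m + 5) * (6 * m + 4)) =
  18 * (m.+1.*2 * (6 * (m * m) + 9 * m + 2)) + 48 * m.+1)%N by lia.
by rewrite addnK; lia.
Qed.

Lemma iter_shift (J : Type) r (x : J * Y) :
  iter r (@shift J) x = (x.1, (x.2.1, inZp (x.2.2 + r))).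
Proof.
case: x => j [p a]; elim: r => [|r IH] /=.
  by congr (_, (_, _)); apply: val_inj; rewrite /= addn0 modn_small.
by rewrite IH /shift /=; congr (_, (_, _)); apply: val_inj; rewrite /= modnDm addn1 addnS.
Qed.

(** * From 4-subsets to matrices *)

Section Matrices.
Variables (u m : nat) (row_of : 'I_u -> 'I_m * bool) (of_row : 'I_m * bool -> 'I_u).
Hypotheses (rowK : cancel row_of of_row) (of_rowK : cancel of_row row_of).
Notation W := ('I_m * Y)%type.

Definition pt (i : 'I_u) (c : 'I_3) : W := ((row_of i).1, ((row_of i).2, c)).
Definition mat (b : {set W}) : 'M[bool]_(u, 3) := \matrix_(i, j) (pt i j \in b).

Lemma sum_pt (Q : pred W) : (\sum_i \sum_j (Q (pt i j) : nat) = #|[set w | Q w]|)%N.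
Proof.
rewrite pair_bigA /= (reindex (fun w : W => (of_row (w.1, w.2.1), w.2.2))) /=; last first.
  exists (fun p => pt p.1 p.2) => [[j [p c]]|[i c]] _; rewrite /pt /= ?of_rowK //.
  by rewrite -surjective_pairing rowK.
rewrite -sum1dep_card [RHS]big_mkcond /=; apply: eq_bigr => -[j [p c]] _.
by rewrite /pt of_rowK /=; case: (Q _).
Qed.

Lemma hweight_mat b : hweight (mat b) = #|b|.
Proof.
rewrite /hweight; under eq_bigr do under eq_bigr do rewrite mxE.
by rewrite (sum_pt (mem b)); apply: eq_card => w; rewrite inE.
Qed.

Lemma corr_mat b c r :
  corr (mat b) (mat c) r = #|[set w in b | iter r (@shift 'I_m) w \in c]|.
Proof.
rewrite -sum_pt /corr; apply: eq_bigr => i _; apply: eq_bigr => j _.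
rewrite (big_pred1 (inZp (j + r))); first by rewrite !mxE iter_shift.
by move=> k; rewrite /= -[RHS]val_eqE.
Qed.

Lemma mat_inj : injective mat.
Proof.
move=> b c e; apply/setP => -[j [p a]].
by have /matrixP/(_ (of_row (j, p)) a) := e; rewrite !mxE /pt of_rowK.
Qed.
End Matrices.

Lemma exists_subset_card (V : finType) (A : {set V}) k : (k <= #|A|)%N ->
  exists2 B : {set V}, B \subset A & #|B| = k.
Proof.
move=> kA; exists [set x in take k (enum A)].
  by apply/subsetP => x; rewrite inE => /mem_take; rewrite mem_enum.
by rewrite cardsE (card_uniqP _) ?take_uniq ?enum_uniq // size_takel // -cardE.
Qed.

Local Close Scope ring_scope.
Unset Implicit Arguments.

Theorem theorem9p12 (u : nat) (hu : 0 < u) (heven : ~~ odd u) :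
  exists C : {set 'M[bool]_(u, 3)}, is_OOC_4_2 C /\ #|C| = Jstar u 3.
Proof.
have [m um] : exists m, u = m.*2 by exists u./2; rewrite even_halfK.
have m0 : (0 < m)%N by rewrite um double_gt0 in hu.
have [q qP] := full_decomposable (design_exists m0).
pose s := @shift 'I_m.
have s3 x : s (s (s x)) = x.
  case: x => j [p a]; rewrite /s /shift /=; congr (_, (_, _)); rewrite -!addrA.
  by rewrite (_ : 1 + (1 + 1) = 0)%R ?addr0 //; apply: val_inj.
have s1 x : s x != x.
  by case: x => j [p a]; rewrite /s /shift !xpair_eqE !eqxx /=; apply: Z3_add1_neq.
have Ts x : full x (s x) (s (s x)) = false.
  case: x => j [p a]; rewrite /full /s /shift /= !eqxx /= /distinct3.
  by case: a => [[|[|[|]]]] //= h; rewrite andbF.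
have cE : #|'I_u| = #|{: 'I_m * bool}| by rewrite card_prod card_bool !card_ord um muln2.
pose rf (i : 'I_u) : 'I_m * bool := enum_val (cast_ord cE (enum_rank i)).
pose fr (j : 'I_m * bool) : 'I_u := enum_val (cast_ord (esym cE) (enum_rank j)).
have rfK : cancel rf fr by move=> j; rewrite /rf /fr enum_valK cast_ordK enum_rankK.
have frK : cancel fr rf by move=> j; rewrite /rf /fr enum_valK cast_ordKV enum_rankK.
(* The count shows that there are at least [Jstar u 3] orbits; a set of exactly that many
   representatives is kept. *)
have [|B BR cB] := @exists_subset_card _ (reps s (@full 'I_m) q) (Jstar u 3).
  rewrite -(leq_pmul2l (isT : 0 < 72)%N) um (leq_trans (Jstar_bound m0)) //.
  by rewrite (leq_trans (card_full m)) // (card_reps qP s3).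
exists (mat rf @: B); split; last by rewrite card_imset //; apply: mat_inj frK.
split=> [A /imsetP[b /(subsetP BR) bR ->]|A A' r /imsetP[b bB ->] /imsetP[c cB' ->] ne].
  rewrite (hweight_mat rfK frK).
  have /blockP[x [y [z [t ->]]]] := reps_block qP bR.
  by rewrite (card_block qP t).
rewrite (corr_mat rfK frK); apply: (reps_corr qP s3 Ts s1); rewrite ?(subsetP BR) //.
by apply: contraTT ne; rewrite !negb_or !negbK => /andP[/eqP -> ->]; rewrite eqxx.
Qed.
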